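(* For every real $\alpha\in(0,\tfrac12)$ there is $\nu_1=\nu_1(\alpha)$ such that for every $\nu>\nu_1$, the random graph $G_{\mathrm{Po}}(n;\alpha,\nu)$ has a Hamilton cycle (and hence a near perfect matching) with probability $1-o(n^{-1/2})$ as $n\to\infty$.
   Context: KPKVB model: fix $\alpha>0$, $\nu>0$, an integer $n>\nu$, and $R=2\ln(n/\nu)$. $\mathcal D_R$ is the hyperbolic disk (curvature $-1$) of radius $R$ around the origin, with polar coordinates $(r,\theta)$, $r\in[0,R)$, $\theta\in(0,2\pi]$; $f_{\alpha,R}(r,\theta)=\frac{\alpha\sinh(\alpha r)}{2\pi(\cosh(\alpha R)-1)}$. Poissonised model $G_{\mathrm{Po}}(n;\alpha,\nu)$: the vertex set is a Poisson point process $\mathcal P$ on $\mathcal D_R$ with intensity measure $n f_{\alpha,R}(r,\theta)\,dr\,d\theta$, two distinct points adjacent iff their hyperbolic distance is at most $R$. A near perfect matching is a matching covering all but at most one vertex. *)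

(* Defs.v *)
From HB Require Import structures.
From mathcomp Require Import all_boot all_order all_algebra.
From mathcomp Require Import all_classical all_reals all_analysis.
Set Implicit Arguments. Unset Strict Implicit. Unset Printing Implicit Defensive.
Import Order.TTheory GRing.Theory Num.Theory numFieldNormedType.Exports.
Local Open Scope classical_set_scope.
Local Open Scope ring_scope.

Section KPKVB.
Variable R : realType.

Definition coshR (x : R) : R := (expR x + expR (- x)) / 2.
Definition sinhR (x : R) : R := (expR x - expR (- x)) / 2.
Definition acoshR (y : R) : R := ln (y + Num.sqrt (y ^+ 2 - 1)).

(* hyperbolic distance (curvature -1) between points given in polar
   coordinates (r, theta) *)
Definition hdist (p q : R * R) : R :=
  acoshR (coshR p.1 * coshR q.1 - sinhR p.1 * sinhR q.1 * cos (p.2 - q.2)).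

Definition diskR (Rad : R) : set (R * R) :=
  [set z | 0 <= z.1 < Rad /\ 0 < z.2 <= 2 * pi].

Definition f_alpha (alpha Rad : R) (z : R * R) : R :=
  alpha * sinhR (alpha * z.1) / (2 * pi * (coshR (alpha * Rad) - 1)).

Definition dens (alpha Rad : R) (z : R * R) : R :=
  if `[< diskR Rad z >] then f_alpha alpha Rad z else 0.

Definition kp_radius (nu : R) (n : nat) : R := 2 * ln (n%:R / nu).

Definition hadj (Rad : R) (x : nat -> R * R) : rel nat :=
  fun i j => (i != j) && (hdist (x i) (x j) <= Rad).

Definition hamiltonian (Rad : R) (m : nat) (x : nat -> R * R) : Prop :=
  (3 <= m)%N /\
  exists s : seq nat, perm_eq s (iota 0 m) /\ cycle (hadj Rad x) s.

(* (N, X) is a realisation of the Poisson point process on D_R with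
   intensity n f_{alpha,R}(r,theta) dr dtheta, represented (as usual for a
   finite intensity measure of total mass n) as: N ~ Poisson(n), the points
   X 0, X 1, ... i.i.d. with density dens, and N independent of (X i)_i;
   the point set is {X 0, ..., X (N-1)}. *)
Definition is_KPKVB_poisson (d : measure_display) (Omega : measurableType d)
  (P : probability Omega R) (alpha nu : R) (n : nat)
  (N : Omega -> nat) (X : nat -> Omega -> R * R) : Prop :=
  let Rad := kp_radius nu n in
  (forall k, measurable [set w | N w = k]) /\
  (forall i, measurable_fun setT (X i)) /\
  (forall k, P [set w | N w = k] =
             (expR (- n%:R) * n%:R ^+ k / (k`!)%:R)%:E) /\
  (forall i (B : set (R * R)), measurable B ->
     P (X i @^-1` B) =
     (\int[(@lebesgue_measure R) \x (@lebesgue_measure R)]_(z in B)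
        (dens alpha Rad z)%:E)%E) /\
  (forall k (I : seq nat) (B : nat -> set (R * R)), uniq I ->
     (forall i, measurable (B i)) ->
     P ([set w | N w = k] `&` [set w | forall i, i \in I -> B i (X i w)]) =
     (P [set w | N w = k] * \prod_(i <- I) P (X i @^-1` B i))%E).

End KPKVB.

(* Main.v *)
Require Import Defs.
From HB Require Import structures.
From mathcomp Require Import all_boot all_order all_algebra.
From mathcomp Require Import all_classical all_reals all_analysis.
From mathcomp Require Import measurable_realfun.
From mathcomp Require Import zify ring lra.
Import Order.TTheory GRing.Theory Num.Theory numFieldNormedType.Exports.

(* Cut the circle into 8 * 4^K angular blocks, grouped dyadically, and say that
   a point has level k when its distance to the boundary is about k ln 4.  A
   level-k point is adjacent to all points of level <= k in its block of level
   k, and level-K points (distance at most Rad / 2 to the centre) are pairwise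
   adjacent.  Hence, going up the binary tree of blocks, the number M of paths
   needed to cover a block satisfies M <= max (1, M' + M'' - L), where M', M''
   belong to the two halves of the block and L is the Poisson number of level-k
   points in the block, and there is a Hamilton cycle as soon as L > M' + M'' in
   each block of level K.  As alpha < 1/2, the mean
   of L grows like nu * 2^((1 - 2 alpha) k), so for nu large E 2^M <= 4 on all
   levels, and the last step fails with probability at most
   8 * 2^K * 16 exp (- 3 * 2^((1 - 2 alpha) K)) = O (1/n), since n is about
   nu * 4^K. *)

(** * Merging paths along a dyadic tree *)

(** Adjacency at radius r tolerates angles of order exp (- r / 2). Moving inwards by ln 4 doubles
    this tolerance, so radial layers of width ln 4 match a binary tree of blocks. The same move
    multiplies the mass per unit angle by 4 ^ (- alpha), hence the mass of a node by 2 ^ (1 - 2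
    alpha); this factor exceeds 1 exactly when alpha < 1/2. The obstacle is the law of the path
    bound, a recursion with a maximum and a truncated subtraction. Bounding 2 ^ max (1, a) by 2 + 2
    ^ a dominates 2 ^ M by a sum of products over the points, and such products have explicit
    Poisson expectations. So independence of the process on disjoint regions is never stated: the
    law of N and the independent marks are enough, and disjointness reappears as additivity in an
    exponent. *)

Section MergingPaths.
Variables (T : eqType) (e : rel T).
Hypothesis e_sym : symmetric e.

(** Each vertex c of [C] replaces two paths p, q by p, c, q. Once at most one path is left, the rest
    of the clique [C] is appended to it. *)
Lemma merge_paths (C : seq T) (ss : seq (seq T)) :
  {in C & flatten ss, forall c x, e c x} ->
  pairwise e C ->
  all (sorted e) ss ->
  exists ss', [/\ perm_eq (flatten ss') (C ++ flatten ss), all (sorted e) ss' &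
                  size ss' <= maxn 1 (size ss - size C)].
Proof.
elim: C ss => [|c C IH] ss eC clC sss.
  by exists ss; split => //; rewrite leq_max subn0 leqnn orbT.
move: clC => /= /andP[/allP ec clC].
have join_sorted p q : {subset p <= flatten ss} -> sorted e p ->
    {in q, forall x, e c x} -> sorted e q -> sorted e (p ++ c :: q).
  move=> psub sp eq_ sq.
  have spc : path e c q.
    by case: q eq_ sq => //= x q -> //; rewrite inE eqxx.
  case: p psub sp => [|x p] psub sp //=.
  rewrite cat_path /= spc andbT; apply/andP; split => //.
  rewrite e_sym; apply: eC; first by rewrite inE eqxx.
  exact/psub/mem_last.
case: ss eC sss join_sorted => [|p [|q ss]] eC sss join_sorted.
- exists [:: c :: C]; split => //=; rewrite ?cats0 // ?leq_max // andbT.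
  by apply: (join_sorted [::] C) => //; exact: pairwise_sorted.
- exists [:: p ++ c :: C]; split => //=; rewrite ?cats0 ?leq_max //.
    by apply/permP => a; rewrite /= !count_cat /= ?count_cat; lia.
  rewrite andbT; apply: join_sorted => //=.
  + by move=> x; rewrite cats0.
  + by move: sss => /= /andP[].
  + exact: pairwise_sorted.
- have [] := IH ((p ++ c :: q) :: ss).
  + move=> a x aC xs; have := ec a aC.
    move: xs; rewrite /= !mem_cat inE orbA => /orP[/orP[/orP[xp|/eqP ->]|xq]|xs] eca.
    * by apply: eC; rewrite ?inE ?aC ?orbT //= !mem_cat xp.
    * by rewrite e_sym.
    * by apply: eC; rewrite ?inE ?aC ?orbT //= !mem_cat xq !orbT.
    * by apply: eC; rewrite ?inE ?aC ?orbT //= !mem_cat xs !orbT.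
  + exact: clC.
  + move: sss => /= /and3P[sp sq ->]; rewrite andbT.
    apply: join_sorted => //.
    * by move=> x xp; rewrite /= mem_cat xp.
    * by move=> x xq; apply: eC; rewrite ?inE ?eqxx //= !mem_cat xq orbT.
  + move=> ss' [ps ss's szs]; exists ss'; split => //.
    apply: (perm_trans ps); apply/permP => a.
    by rewrite /= !count_cat /= ?count_cat /= ?count_cat; lia.
Qed.

(** Vertices of [C] and paths alternate, and the surplus of [C] comes last. The strict inequality
    puts a vertex of [C] at both ends, where paths of different top blocks will be joined. *)
Lemma merge_into_path (C : seq T) (ss : seq (seq T)) :
  {in C & flatten ss, forall c x, e c x} ->
  pairwise e C -> all (sorted e) ss -> size ss < size C ->
  exists c q, [/\ perm_eq (c :: q) (C ++ flatten ss), path e c q,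
                  c \in C & last c q \in C].
Proof.
elim: ss C => [|p ss IH] [|c C] //= eC /andP[/allP ec clC].
  move=> _ _; exists c, C; split; rewrite ?cats0 ?inE ?eqxx //; last first.
    by rewrite -in_cons mem_last.
  by apply/(@pairwise_sorted _ e (c :: C))=> /=; rewrite clC andbT; apply/allP.
move=> /andP[sp sss] szs.
have [|//|//|//|c' [q [pq pathq c'C lastC]]] := IH C.
  move=> a x aC xs; apply: eC; first by rewrite inE aC orbT.
  by rewrite mem_cat xs orbT.
exists c, (p ++ c' :: q); split; last 2 first.
- by rewrite inE eqxx.
- by rewrite last_cat /= inE lastC orbT.
- move/permP: pq => pq; apply/permP => a; have := pq a.
  by rewrite /= !count_cat /= ?count_cat; lia.
- have ecp x : x \in p -> e c x.
    by move=> xp; apply: eC; rewrite ?inE ?eqxx // mem_cat xp.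
  case: p sp ecp eC => [|x p] sp ecp eC /=; first by rewrite ec //= pathq.
  move: sp => /= sp.
  rewrite cat_path /= pathq andbT ecp ?inE ?eqxx //= sp /= e_sym.
  by apply: eC; [rewrite inE c'C orbT|rewrite mem_cat mem_last].
Qed.

End MergingPaths.

Section DyadicBlocks.
Variables (I : Type) (lv bx : I -> nat).

Definition in_block k j i := (lv i <= k) && (bx i %/ 2 ^ k == j).
Definition at_node k j i := (lv i == k) && (bx i %/ 2 ^ k == j).

(** The disjoint union is written as a sum of booleans in [nat], which serves both for counting
    permutations and for seeing that at most one part contains [i]. *)
Lemma in_block_split k j i :
  (in_block k.+1 j i =
   at_node k.+1 j i + in_block k j.*2 i + in_block k j.*2.+1 i :> nat)%N.
Proof.
rewrite /in_block /at_node expnSr divnMA.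
move: (bx i %/ 2 ^ k) => b; case: (ltngtP (lv i) k.+1) => h //=.
- have -> : lv i <= k by lia.
  by case: (b %/ 2 =P j) => h1; case: (b =P j.*2) => h2;
    case: (b =P j.*2.+1) => h3 /=; lia.
- by rewrite leqNgt (ltn_trans _ h).
- by rewrite h ltnn /= !addn0.
Qed.

End DyadicBlocks.
Arguments in_block {I}.
Arguments at_node {I}.

(* A point at node (k + 1, j) is adjacent to all of its block, so each such
   point glues two of the paths left over by the two halves of the block. *)
Fixpoint paths_bound (cnt : nat -> nat -> nat) k j :=
  if k is k'.+1 then
    maxn 1 (paths_bound cnt k' j.*2 + paths_bound cnt k' j.*2.+1
            - cnt k'.+1 j)
  else 1.

Section DyadicMerging.
Variables (lv bx : nat -> nat).
Local Notation inB := (in_block lv bx).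
Local Notation atN := (at_node lv bx).
Definition node_count N k j := count (atN k j) (iota 0 N).

Lemma perm_in_block s k j :
  perm_eq (seq.filter (inB k.+1 j) s)
    (seq.filter (atN k.+1 j) s ++ seq.filter (inB k j.*2) s
     ++ seq.filter (inB k j.*2.+1) s).
Proof.
apply/permP => a; rewrite !count_cat !count_filter.
elim: s => //= i s ->.
have := in_block_split _ lv bx k j i.
by case: (a i) => /=; lia.
Qed.

Variables (e : rel nat) (N K : nat).
Hypothesis e_sym : symmetric e.
Hypothesis e_block : forall i i' k, i < N -> i' < N -> i != i' -> k <= K ->
  lv i = k -> lv i' <= k -> bx i %/ 2 ^ k = bx i' %/ 2 ^ k -> e i i'.
Hypothesis e_top : forall i i', i < N -> i' < N -> i != i' ->
  lv i = K -> lv i' = K -> e i i'.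

Lemma node_block_adj k j : k <= K ->
  {in seq.filter (atN k j) (iota 0 N) & seq.filter (inB k j) (iota 0 N),
     forall i i', i != i' -> e i i'}.
Proof.
move=> kK i i'; rewrite !mem_filter !mem_iota /= !add0n.
move=> /andP[/andP[/eqP lvi /eqP bxi] iN] /andP[/andP[lvi' /eqP bxi'] iN'] ii'.
by apply: (@e_block i i' k) => //; rewrite bxi bxi'.
Qed.

Lemma node_clique k j : k <= K ->
  pairwise e (seq.filter (atN k j) (iota 0 N)).
Proof.
move=> kK; set s := seq.filter _ _.
have us : uniq s by rewrite filter_uniq ?iota_uniq.
move: us; rewrite uniq_pairwise.
apply: (@sub_in_pairwise _ (mem s)); last exact/allP.
move=> i i' si si' /= ii'; apply: (@node_block_adj k j) => //.
move: si'; rewrite !mem_filter => /andP[/andP[/eqP lvi bxi] ->].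
by rewrite /in_block lvi leqnn bxi.
Qed.

Lemma children_adj k j : k < K -> forall ss ss',
  perm_eq (flatten ss) (seq.filter (inB k j.*2) (iota 0 N)) ->
  perm_eq (flatten ss') (seq.filter (inB k j.*2.+1) (iota 0 N)) ->
  {in seq.filter (atN k.+1 j) (iota 0 N) & flatten (ss ++ ss'),
     forall i i', e i i'}.
Proof.
move=> kK ss ss' ps ps' i i' si; rewrite flatten_cat mem_cat.
rewrite (perm_mem ps) (perm_mem ps') => si'.
have [lvi' ini'] : lv i' <= k /\ i' \in seq.filter (inB k.+1 j) (iota 0 N).
  rewrite (perm_mem (perm_in_block _ _ _)) !mem_cat si' orbT; split=> //.
  by move: si'; rewrite !mem_filter /in_block => /orP[] /andP[] /andP[].
apply: (@node_block_adj k.+1 j) => //.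
apply: contraTneq lvi' => <-; move: si.
by rewrite mem_filter => /andP[/andP[/eqP -> _] _]; rewrite ltnn.
Qed.

Lemma cover_block k j : k <= K -> exists ss,
  [/\ perm_eq (flatten ss) (seq.filter (inB k j) (iota 0 N)),
      all (sorted e) ss & size ss <= paths_bound (node_count N) k j].
Proof.
elim: k j => [|k IH] j kK.
  (* The level-0 points of a smallest block form a clique, hence one path; an empty block also
     counts as one, empty, path. *)
  exists [:: seq.filter (atN 0 j) (iota 0 N)]; split => //=.
    rewrite cats0; apply/permP => a; rewrite !count_filter.
    by apply: eq_count => i /=; rewrite /in_block /at_node leqn0.
  by rewrite andbT; exact/pairwise_sorted/node_clique.
have [ss [pss sss szss]] := IH j.*2 (ltnW kK).
have [ss' [pss' sss' szss']] := IH j.*2.+1 (ltnW kK).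
have [|||ss'' [pss'' sss'' szss'']] :=
  @merge_paths _ e e_sym (seq.filter (atN k.+1 j) (iota 0 N)) (ss ++ ss').
- exact: children_adj.
- exact: node_clique.
- by rewrite all_cat sss.
exists ss''; split => //.
  apply: (perm_trans pss''); rewrite perm_sym.
  apply: (perm_trans (perm_in_block _ _ _)).
  by rewrite perm_cat2l flatten_cat perm_sym; exact: perm_cat.
apply: (leq_trans szss'') => /=.
by rewrite size_cat size_filter geq_max leq_maxl /= leq_max leq_sub2r ?orbT ?leq_add.
Qed.

Lemma top_path k j : K = k.+1 ->
  paths_bound (node_count N) k j.*2 + paths_bound (node_count N) k j.*2.+1
    < node_count N k.+1 j ->
  exists c q, [/\ perm_eq (c :: q) (seq.filter (inB K j) (iota 0 N)),
    path e c q, lv c = K & lv (last c q) = K].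
Proof.
move=> Kk enough; have kK : k < K by rewrite Kk.
have [ss [pss sss szss]] := @cover_block k j.*2 (ltnW kK).
have [ss' [pss' sss' szss']] := @cover_block k j.*2.+1 (ltnW kK).
have [||||c [q [pq pathq cC lastC]]] :=
  @merge_into_path _ e e_sym (seq.filter (atN k.+1 j) (iota 0 N)) (ss ++ ss').
- exact: children_adj.
- exact: node_clique.
- by rewrite all_cat sss.
- by rewrite size_cat size_filter; exact: leq_ltn_trans (leq_add szss szss') enough.
exists c, q; split => //.
- apply: (perm_trans pq); rewrite Kk perm_sym.
  apply: (perm_trans (perm_in_block _ _ _)).
  by rewrite perm_cat2l flatten_cat perm_sym; exact: perm_cat.
- by move: cC; rewrite mem_filter -Kk => /andP[/andP[/eqP ]].
- by move: lastC; rewrite mem_filter -Kk => /andP[/andP[/eqP ]].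
Qed.

Definition good_blocks m := forall j, j < m -> exists c q,
  [/\ perm_eq (c :: q) (seq.filter (inB K j) (iota 0 N)),
    path e c q, lv c = K & lv (last c q) = K].

(** Consecutive block paths are linked through their ends, which have level [K] and are adjacent
    wherever they lie. The length bound holds because every block path is nonempty; it later yields
    the three vertices of a cycle. *)
Lemma concat_paths m : good_blocks m.+1 ->
  exists c q, [/\ perm_eq (c :: q)
     (seq.filter (fun i => (lv i <= K) && (bx i %/ 2 ^ K < m.+1)) (iota 0 N)),
    path e c q, lv c = K, lv (last c q) = K & m < (size q).+1].
Proof.
elim: m => [|m IH] good.
  have [c [q [pq pathq cK lK]]] := good 0 isT.
  exists c, q; split => //; apply: (perm_trans pq); apply/permP => a.
  by rewrite !count_filter; apply: eq_count => i /=; rewrite /in_block ltnS leqn0.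
have [|c [q [pq pathq cK lK szq]]] := IH.
  by move=> j jm; apply: good; rewrite ltnS ltnW.
have [c' [q' [pq' pathq' cK' lK']]] := good m.+1 (ltnSn _).
have cover : perm_eq ((c :: q) ++ (c' :: q'))
   (seq.filter (fun i => (lv i <= K) && (bx i %/ 2 ^ K < m.+2)) (iota 0 N)).
  apply: (perm_trans (perm_cat pq pq')).
  apply/permP => a; rewrite count_cat !count_filter.
  elim: (iota 0 N) => //= i s.
  have -> : (bx i %/ 2 ^ K < m.+2) = (bx i %/ 2 ^ K < m.+1) || (bx i %/ 2 ^ K == m.+1).
    by rewrite [LHS]ltnS leq_eqVlt orbC.
  rewrite /in_block.
  by case: (a i); case: (lv i <= K); case: (ltngtP (bx i %/ 2 ^ K) m.+1) => h /=; lia.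
exists c, (q ++ c' :: q'); split => //.
- rewrite cat_path /= pathq pathq' andbT /=.
  have inN i : i \in (c :: q) ++ (c' :: q') -> i < N.
    by rewrite (perm_mem cover) mem_filter mem_iota => /and3P[].
  apply: e_top => //.
  + by apply: inN; rewrite mem_cat mem_last.
  + by apply: inN; rewrite mem_cat mem_head orbT.
  + have : uniq ((c :: q) ++ (c' :: q')).
      by rewrite (perm_uniq cover) filter_uniq ?iota_uniq.
    rewrite cat_uniq => /and3P[_ /hasPn /(_ c') + _].
    rewrite mem_head => /(_ isT) /= h; apply: contraNneq h => <-.
    exact: mem_last.
- by rewrite last_cat.
- by rewrite size_cat /= addnS ltnS; apply: leq_trans szq _; rewrite ltnS leq_addr.
Qed.

Theorem dyadic_hamilton_cycle k m : K = k.+1 -> 2 < m ->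
  (forall i, i < N -> lv i <= K) -> (forall i, i < N -> bx i < m * 2 ^ K) ->
  (forall j, j < m ->
    paths_bound (node_count N) k j.*2 + paths_bound (node_count N) k j.*2.+1
      < node_count N k.+1 j) ->
  2 < N /\ exists s, perm_eq s (iota 0 N) /\ cycle e s.
Proof.
move=> Kk m2 lvK bxm enough; case: m m2 bxm enough => // m m2 bxm enough.
have [|c [q [pq pathq cK lK szq]]] := @concat_paths m.
  by move=> j jm; apply: (@top_path k) => //; exact: enough.
have cover : perm_eq (c :: q) (iota 0 N).
  apply: (perm_trans pq); rewrite (@eq_in_filter _ _ predT) ?filter_predT //.
  move=> i; rewrite mem_iota add0n => /= iN.
  by rewrite lvK //= ltn_divLR ?expn_gt0 // bxm.
have szN : size (c :: q) = N by rewrite (perm_size cover) size_iota.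
split; first by rewrite -szN /=; exact: leq_trans m2 szq.
exists (c :: q); split => //=; rewrite rcons_path pathq /=.
have inN i : i \in c :: q -> i < N by rewrite (perm_mem cover) mem_iota.
apply: e_top => //; first exact/inN/mem_last.
  exact/inN/mem_head.
have : uniq (c :: q) by rewrite (perm_uniq cover) iota_uniq.
rewrite /= => /andP[cq _]; apply: contraNneq cq => <-.
case: q {pq pathq lK cover inN szN} szq => [|x q] szq; last exact: mem_last.
by have := leq_trans m2 szq.
Qed.

End DyadicMerging.

Local Open Scope classical_set_scope.
Local Open Scope ring_scope.

(** * Hyperbolic distance estimates *)

Section HyperbolicGeometry.
Variable R : realType.
Implicit Types r s x y : R.

Lemma expR_ge1 x : 0 <= x -> 1 <= expR x.
Proof. by move=> x0; rewrite -expR0 ler_expR. Qed.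

Lemma sin_le_id x : 0 <= x -> sin x <= x.
Proof.
move=> x0.
have dsin y : y \in `]0, x[ -> is_derive y 1 sin (cos y).
  by move=> _; exact: is_derive_sin.
have csin : {within `[0, x], continuous (@sin R)}.
  by apply: continuous_subspaceT => y; exact: continuous_sin.
have [c _] := MVT_segment x0 dsin csin.
by rewrite sin0 !subr0 => ->; rewrite ler_piMl ?cos_le1.
Qed.

Lemma one_minus_cos_le x : 1 - cos x <= x ^+ 2 / 2.
Proof.
wlog x0 : x / 0 <= x.
  move=> H; have [/H //|/ltW x0] := leP 0 x.
  by have := H (- x); rewrite cosN sqrrN oppr_ge0; exact.
have -> : cos x = 1 - (sin (x / 2)) ^+ 2 *+ 2.
  have x2 : x / 2 *+ 2 = x by rewrite -mulr_natr divfK ?pnatr_eq0.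
  by rewrite -{1}x2 cos_mulr2n cos2sin2; ring.
have h0 : 0 <= x / 2 by lra.
suff : sin (x / 2) ^+ 2 <= (x / 2) ^+ 2 by rewrite !expr2; lra.
rewrite -[leLHS]real_normK ?num_real // lerXn2r ?nnegrE //.
rewrite ler_norml sin_le_id // andbT.
(* Past pi the sine may be negative, but there - x / 2 is already below - 1. *)
have [x_le|x_gt] := leP (x / 2) pi.
  by apply: (@le_trans _ _ 0); [lra|rewrite sin_ge0_pi// h0].
apply: le_trans (sin_geN1 _); have := pi_ge2 R; lra.
Qed.

Lemma ler_coshR x y : 0 <= x -> x <= y -> coshR x <= coshR y.
Proof.
move=> x0 xy; rewrite /coshR.
have ab : 1 <= expR x by rewrite expR_ge1.
have bc : expR x <= expR y by rewrite ler_expR.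
rewrite !expRN ler_pM2r ?invr_gt0//.
move: (expR x) (expR y) ab bc => a b ab bc.
have a0 : 0 < a by lra.
have b0 : 0 < b by lra.
rewrite -subr_ge0.
have -> : b + b^-1 - (a + a^-1) = (b - a) * (a * b - 1) / (a * b).
  by field; rewrite !gt_eqF.
by rewrite divr_ge0 ?mulr_ge0 ?subr_ge0// ?(ltW a0) ?(ltW b0)//; nra.
Qed.

Lemma acoshR_le_coshR y Rad : 0 <= y -> 0 <= Rad -> y <= coshR Rad ->
  acoshR y <= Rad.
Proof.
move=> y0 Rad0 yR; rewrite /acoshR.
(* Nothing forces 1 <= y, so the default values matter: the root of a negative number is 0, and so
   is [ln] at 0. *)
have [y1|y1] := ltP (y + Num.sqrt (y ^+ 2 - 1)) 1.
  have [h|h] := leP (y + Num.sqrt (y ^+ 2 - 1)) 0.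
    by rewrite ln0.
  by apply: le_trans Rad0; rewrite ln_le0// ltW.
rewrite -[leRHS]expRK ler_ln ?posrE ?expR_gt0 ?(lt_le_trans ltr01)//.
have -> : expR Rad = coshR Rad + Num.sqrt ((sinhR Rad) ^+ 2).
  rewrite sqrtr_sqr ger0_norm.
    by rewrite /coshR /sinhR; lra.
  by rewrite /sinhR divr_ge0 // subr_ge0 ler_expR; lra.
apply: lerD => //; apply: ler_wsqrtr.
have -> : sinhR Rad ^+ 2 = coshR Rad ^+ 2 - 1.
  have : expR Rad * expR (- Rad) = 1 by rewrite -expRD subrr expR0.
  rewrite /coshR /sinhR; move: (expR Rad) (expR (- Rad)) => a b ab.
  have -> : ((a - b) / 2) ^+ 2 = ((a + b) / 2) ^+ 2 - a * b by field.
  by rewrite ab.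
by rewrite lerB// lerXn2r ?nnegrE// (le_trans y0).
Qed.

Lemma hdist_le (p q : R * R) Rad : 0 <= p.1 -> 0 <= q.1 -> 0 <= Rad ->
  coshR p.1 * coshR q.1 - sinhR p.1 * sinhR q.1 * cos (p.2 - q.2)
    <= coshR Rad -> hdist p q <= Rad.
Proof.
move=> p0 q0 Rad0; apply: acoshR_le_coshR => //.
have sc x : 0 <= x -> 0 <= sinhR x <= coshR x.
  move=> x0; have : expR (- x) <= expR x by rewrite ler_expR; lra.
  have := expR_gt0 (- x); rewrite /sinhR /coshR => ? ?.
  by apply/andP; split; lra.
have /andP[sp cp] := sc _ p0; have /andP[sq cq] := sc _ q0.
rewrite subr_ge0; apply: (@le_trans _ _ (sinhR p.1 * sinhR q.1)).
  by apply: ler_piMr; [exact: mulr_ge0|exact: cos_le1].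
exact: ler_pM.
Qed.

Lemma hdistC (p q : R * R) : hdist p q = hdist q p.
Proof.
rewrite /hdist -[p.2 - q.2]opprB cosN.
by congr acoshR; ring.
Qed.

Lemma hadj_sym Rad (x : nat -> R * R) : symmetric (hadj Rad x).
Proof. by move=> i j; rewrite /hadj eq_sym hdistC. Qed.

(** Triangle inequality through the origin: the worst cosine is - 1, which gives cosh of the sum of
    the radii. *)
Lemma hdist_le_of_add (p q : R * R) Rad : 0 <= p.1 -> 0 <= q.1 ->
  p.1 + q.1 <= Rad -> hdist p q <= Rad.
Proof.
move=> p0 q0 pq; have Rad0 : 0 <= Rad by lra.
apply: hdist_le => //.
have sinh_ge0 x : 0 <= x -> 0 <= sinhR x.
  move=> x0; rewrite /sinhR divr_ge0// subr_ge0 ler_expR; lra.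
apply: (@le_trans _ _ (coshR (p.1 + q.1))).
  have -> : coshR (p.1 + q.1) = coshR p.1 * coshR q.1 + sinhR p.1 * sinhR q.1.
    by rewrite /coshR /sinhR opprD !expRD; field.
  rewrite lerD2l -mulrN; apply: ler_piMr.
    by apply: mulr_ge0; exact: sinh_ge0.
  by rewrite lerNl; exact: cos_geN1.
by apply: ler_coshR => //; rewrite addr_ge0.
Qed.

(* The distance between radii r <= s does not exceed s as soon as
   tanh (r/2) <= tanh s * cos(angle); since tanh r <= tanh s and
   1/cosh^2 (r/2) >= e^-r, an angle of square at most e^-r suffices. *)
Lemma hdist_le_of_angle (p q : R * R) Rad : 0 <= p.1 -> p.1 <= q.1 ->
  q.1 <= Rad -> (p.2 - q.2) ^+ 2 <= expR (- p.1) -> hdist p q <= Rad.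
Proof.
move=> p0 pq qR ang; have Rad0 : 0 <= Rad by lra.
apply: hdist_le => //; first by lra.
have hc : 1 - expR (- p.1) / 2 <= cos (p.2 - q.2).
  have := one_minus_cos_le (p.2 - q.2).
  by move: ((p.2 - q.2) ^+ 2) ang => z; lra.
apply: (@le_trans _ _ (coshR q.1)); last first.
  by apply: ler_coshR => //; lra.
move: (cos _) hc => c; rewrite /coshR /sinhR !expRN.
have : 1 <= expR p.1 by rewrite expR_ge1.
have : expR p.1 <= expR q.1 by rewrite ler_expR.
move: (expR p.1) (expR q.1) => u v uv u1 hc.
have u0 : 0 < u by lra.
have v0 : 0 < v by lra.
apply: (@le_trans _ _ ((u + u^-1) / 2 * ((v + v^-1) / 2)
    - (u - u^-1) / 2 * ((v - v^-1) / 2) * (1 - u^-1 / 2))).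
  have ge0 x : 1 <= x -> 0 <= (x - x^-1) / 2.
    by move=> x1; rewrite divr_ge0 // subr_ge0 (le_trans _ x1)// invf_le1//; lra.
  by rewrite lerB// ler_wpM2l// mulr_ge0 ?ge0//; lra.
rewrite -subr_ge0.
(* With u and v the exponentials of the two radii, the gap factors into terms that are visibly
   nonnegative for 1 <= u <= v. *)
have -> : (v + v^-1) / 2 - ((u + u^-1) / 2 * ((v + v^-1) / 2)
    - (u - u^-1) / 2 * ((v - v^-1) / 2) * (1 - u^-1 / 2)) =
    (u - 1) * ((v ^+ 2 - u ^+ 2) * (3 * u - 1) + (u - 1) ^+ 2 * (3 * u + 1))
    / (8 * u ^+ 2 * v).
  by field; rewrite !gt_eqF.
have vu : 0 <= v ^+ 2 - u ^+ 2 
  by rewrite subr_ge0; apply: lerXn2r => //; rewrite nnegrE ltW.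
have h1 : 0 <= (v ^+ 2 - u ^+ 2) * (3 * u - 1) by rewrite mulr_ge0//; lra.
have h2 : 0 <= (u - 1) ^+ 2 * (3 * u + 1) by rewrite mulr_ge0 ?sqr_ge0//; lra.
apply: divr_ge0; first by apply: mulr_ge0; [lra|exact: addr_ge0].
by apply: mulr_ge0; [apply: mulr_ge0; [lra|exact: sqr_ge0]|exact: ltW].
Qed.

End HyperbolicGeometry.

(** * Exponential moments of the number of paths *)

Lemma sum_exp_coeff_le (R : realType) (x : R) (M : nat) : 0 <= x ->
  \sum_(0 <= i < M) x ^+ i / i`!%:R <= expR x.
Proof.
move=> x0.
have nd : nondecreasing_seq (series (exp_coeff x)).
  apply: nondecreasing_series => i _ _.
  by rewrite /exp_coeff /= divr_ge0 ?exprn_ge0.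
exact: (nondecreasing_cvgn_le nd (is_cvg_series_exp_coeff x)).
Qed.

Section MultiplicativeFunctionals.
Variables (R : realType) (T : finType) (lv bx : T -> nat).
Notation term := (R * {ffun T -> R})%type.
Implicit Types (l : seq term) (s : seq T).

Definition half_at k j (t : T) : R := if at_node lv bx k j t then 2^-1 else 1.

Definition mul_term k j (c c' : term) : term :=
  (c.1 * c'.1, [ffun t => c.2 t * c'.2 t * half_at k j t]).

Definition join_terms l l' k j : seq term :=
  [seq mul_term k j c c' | c <- l, c' <- l'].

(* 2 ^ paths_bound is at most Z, where Z (0, j) = 2 and
   Z (k + 1, j) = 2 + Z (k, 2 j) Z (k, 2 j + 1) 2 ^ (- count), because
   2 ^ max (1, a) <= 2 + 2 ^ a.  A list of terms (c, w) stands for the sum of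
   the functionals c * prod of w over the marks, whose Poisson expectations are
   explicit; path_terms is the expansion of Z. *)
Fixpoint path_terms k j : seq term :=
  if k is k'.+1 then
    (2, [ffun=> 1]) ::
      join_terms (path_terms k' j.*2) (path_terms k' j.*2.+1) k j
  else [:: (2, [ffun=> 1])].

Definition eval_terms l s := \sum_(c <- l) c.1 * \prod_(t <- s) c.2 t.

Lemma prod_half_at k j s :
  \prod_(t <- s) half_at k j t = 2^-1 ^+ count (at_node lv bx k j) s.
Proof.
elim: s => [|t s IH]; rewrite ?big_nil // big_cons IH /half_at /=.
by case: ifP => _; rewrite ?mul1r // exprS.
Qed.

Lemma eval_join l l' k j s : eval_terms (join_terms l l' k j) s =
  eval_terms l s * eval_terms l' s * 2^-1 ^+ count (at_node lv bx k j) s.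
Proof.
rewrite /eval_terms big_allpairs_dep -mulrA big_distrl /=.
apply: eq_bigr => c _; rewrite big_distrl /= big_distrr /=.
apply: eq_bigr => c' _.
rewrite /mul_term /=; under eq_bigr do rewrite ffunE.
by rewrite big_split big_split /= prod_half_at; ring.
Qed.

Definition nonneg_terms l :=
  all (fun c : term => (0 <= c.1) && [forall t, 0 <= c.2 t <= 1]) l.

Lemma nonneg_join l l' k j :
  nonneg_terms l -> nonneg_terms l' -> nonneg_terms (join_terms l l' k j).
Proof.
move=> /allP nl /allP nl'; apply/allP => _ /allpairsP[[c c'] /= [cl c'l ->]].
rewrite /mul_term /=.
have /andP[c0 /forallP cw] := nl c cl.
have /andP[c'0 /forallP c'w] := nl' c' c'l.
rewrite mulr_ge0//=; apply/forallP => t; rewrite ffunE.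
have /andP[a0 a1] := cw t; have /andP[b0 b1] := c'w t.
have /andP[h0 h1] : 0 <= half_at k j t <= 1.
  by rewrite /half_at; case: ifP => _; apply/andP; split; lra.
by rewrite !mulr_ge0//= mulr_ile1 ?mulr_ge0 ?mulr_ile1.
Qed.

Lemma nonneg_path_terms k j : nonneg_terms (path_terms k j).
Proof.
have h2 : nonneg_terms [:: (2, [ffun=> 1])].
  by rewrite /nonneg_terms /= ler0n andbT; apply/forallP => t; rewrite ffunE ler01 lexx.
elim: k j => [|k IH] j //=.
move: h2; rewrite /nonneg_terms /= andbT => -> /=; exact: nonneg_join.
Qed.

Lemma eval_ge0 l s : nonneg_terms l -> 0 <= eval_terms l s.
Proof.
move=> /allP nl; rewrite /eval_terms big_seq sumr_ge0 // => c /nl /andP[c0 /forallP cw].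
by rewrite mulr_ge0// prodr_ge0// => t _; have /andP[] := cw t.
Qed.

Lemma eval_path_terms_ge k j s :
  2 ^+ paths_bound (fun k j => count (at_node lv bx k j) s) k j
    <= eval_terms (path_terms k j) s.
Proof.
have e2 l : eval_terms ((2, [ffun=> 1]) :: l) s = 2 + eval_terms l s.
  rewrite /eval_terms big_cons /=.
  by rewrite big1 ?mulr1 // => t _; rewrite ffunE.
elim: k j => [|k IH] j; first by rewrite /= e2 /eval_terms big_nil addr0 expr1.
rewrite [path_terms _ _]/= e2 eval_join /=.
set a := paths_bound _ k j.*2; set b := paths_bound _ k j.*2.+1.
set L := count _ _.
have z0 i : 0 <= eval_terms (path_terms k i) s.
  exact/eval_ge0/nonneg_path_terms.
have join_ge : 2 ^+ a * 2 ^+ b * 2^-1 ^+ L <= eval_terms (path_terms k j.*2) s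
    * eval_terms (path_terms k j.*2.+1) s * 2^-1 ^+ L.
  by rewrite ler_wpM2r ?exprn_ge0// ler_pM ?exprn_ge0 ?IH.
have join0 : 0 <= 2 ^+ a * 2 ^+ b * 2^-1 ^+ L :> R.
  by rewrite !mulr_ge0 ?exprn_ge0.
(* If the truncated difference is at most 1, the summand 2 suffices. Otherwise L < a + b and the
   subtraction is exact. *)
case: (leqP (a + b - L) 1) => h.
  by rewrite expr1; lra.
apply: (@le_trans _ _ (2 ^+ a * 2 ^+ b * 2^-1 ^+ L)); last by lra.
rewrite exprVn -exprD -(@subnK L (a + b)) ?addnK; last by lia.
by rewrite exprD mulfK // expf_eq0 pnatr_eq0 andbF.
Qed.

Lemma eval_bad_node k j s :
  (count (at_node lv bx k.+1 j) s <=
   paths_bound (fun k j => count (at_node lv bx k j) s) k j.*2 +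
   paths_bound (fun k j => count (at_node lv bx k j) s) k j.*2.+1)%N ->
  1 <= eval_terms
         (join_terms (path_terms k j.*2) (path_terms k j.*2.+1) k.+1 j) s.
Proof.
move=> bad; rewrite eval_join.
set L := count _ _ in bad *.
apply: (@le_trans _ _ (2 ^+ (paths_bound (fun k j => count (at_node lv bx k j) s) k j.*2)
   * 2 ^+ (paths_bound (fun k j => count (at_node lv bx k j) s) k j.*2.+1) * 2^-1 ^+ L)).
  rewrite -exprD exprVn ler_pdivlMr ?exprn_gt0// mul1r.
  by rewrite ler_weXn2l// ler1n.
rewrite ler_wpM2r ?exprn_ge0//.
by apply: ler_pM; rewrite ?exprn_ge0 ?eval_path_terms_ge.
Qed.

Variables (p : T -> R) (lam : R).
Hypotheses (p_ge0 : forall t, 0 <= p t) (p_sum1 : \sum_t p t = 1).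
Hypothesis lam_ge0 : 0 <= lam.

Definition node_mass k j := \sum_(t | at_node lv bx k j t) p t.

(* The expectation of eval_terms at a Poisson (lam) number of independent marks
   of law p. *)
Definition laplace l :=
  \sum_(c <- l) c.1 * expR (- (lam * \sum_t p t * (1 - c.2 t))).

Definition supported k j l :=
  all (fun c : term => [forall t, in_block lv bx k j t || (c.2 t == 1)]) l.

Lemma laplace_ge0 l : nonneg_terms l -> 0 <= laplace l.
Proof.
move=> /allP nl; rewrite /laplace big_seq sumr_ge0 // => c /nl /andP[c0 _].
by rewrite mulr_ge0// expR_ge0.
Qed.

(** This is the independence of a Poisson process on disjoint sets. At each mark at most one of the
    three factors differs from 1, so one minus their product is the sum of their defects, and the
    exponents add up. *)
Lemma laplace_join k j l l' :
  supported k j.*2 l -> supported k j.*2.+1 l' ->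
  laplace (join_terms l l' k.+1 j) =
  laplace l * laplace l' * expR (- (lam * node_mass k.+1 j / 2)).
Proof.
move=> /allP sl /allP sl'.
rewrite /laplace big_allpairs_dep -mulrA big_distrl /=.
apply: eq_big_seq => c /sl /forallP cw; rewrite big_distrl /= big_distrr /=.
apply: eq_big_seq => c' /sl' /forallP c'w; rewrite /mul_term /=.
transitivity (c.1 * c'.1 *
  (expR (- (lam * \sum_t p t * (1 - c.2 t))) *
   expR (- (lam * \sum_t p t * (1 - c'.2 t))) *
   expR (- (lam * node_mass k.+1 j / 2)))); last by ring.
rewrite -!expRD; congr (_ * expR _).
rewrite -!opprD -mulrA -!mulrDr; congr (- (_ * _)).
have -> : node_mass k.+1 j / 2 = \sum_t p t * (1 - half_at k.+1 j t).
  rewrite /node_mass big_mkcond big_distrl /=; apply: eq_bigr => t _.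
  by rewrite /half_at; case: ifP => _; field.
rewrite -!big_split /=; apply: eq_bigr => t _.
rewrite ffunE -!mulrDr; congr (_ * _).
have ca : ~~ in_block lv bx k j.*2 t -> c.2 t = 1.
  by move=> /negPf h; have := cw t; rewrite h => /eqP.
have cb : ~~ in_block lv bx k j.*2.+1 t -> c'.2 t = 1.
  by move=> /negPf h; have := c'w t; rewrite h => /eqP.
have disj : (at_node lv bx k.+1 j t + in_block lv bx k j.*2 t
             + in_block lv bx k j.*2.+1 t <= 1)%N.
  by rewrite -in_block_split leq_b1.
move: ca cb disj; rewrite /half_at; case: (in_block _ _ _ j.*2 t);
  case: (in_block _ _ _ j.*2.+1 t); case: (at_node _ _ _ _ t) => //= ca cb _;
  rewrite ?(ca isT) ?(cb isT); ring.
Qed.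

Lemma supported_join k j l l' :
  supported k j.*2 l -> supported k j.*2.+1 l' ->
  supported k.+1 j (join_terms l l' k.+1 j).
Proof.
move=> /allP sl /allP sl'; apply/allP => _ /allpairsP[[c c'] /= [cl c'l ->]].
apply/forallP => t; rewrite /mul_term /= ffunE.
move: (sl c cl) (sl' c' c'l) => /forallP /(_ t) cw /forallP /(_ t) c'w.
have := in_block_split _ lv bx k j t; case: (in_block _ _ k.+1 _ t) => //=.
move: cw c'w; rewrite /half_at; case: (in_block _ _ _ j.*2 t) => //=;
case: (in_block _ _ _ j.*2.+1 t) => //=; case: (at_node _ _ _ _ t) => //=.
by move=> /eqP -> /eqP ->; rewrite !mulr1 eqxx.
Qed.

Lemma supported_path_terms k j : supported k j (path_terms k j).
Proof.
have h l i k' : supported k' i ((2, [ffun=> 1]) :: l) = supported k' i l.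
  rewrite /supported /=; case: (X in X && _) / idP => //= -[].
  by apply/forallP => t; rewrite ffunE eqxx orbT.
elim: k j => [|k IH] j; rewrite [path_terms _ _]/= h //; exact: supported_join.
Qed.

Lemma expRN3_le : expR (- 3) <= 8^-1 :> R.
Proof.
rewrite expRN lef_pV2 ?posrE ?expR_gt0//.
have -> : 8 = 2 ^+ 3 :> R by rewrite -natrX.
rewrite -[X in expR X]mulr1 expRM_natl lerXn2r ?nnegrE ?expR_ge0//.
by apply: le_trans (expR_ge1Dx 1); lra.
Qed.

(** The bound 4 reproduces itself: a node of mean 6 contributes exp (- 6 / 2) <= 1 / 8, and 2 + 4 *
    4 / 8 = 4. *)
Lemma laplace_path_terms_le K m :
  (forall k j, (0 < k <= K)%N -> (j < m * 2 ^ (K - k))%N ->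
     6 <= lam * node_mass k j) ->
  forall k j, (k <= K)%N -> (j < m * 2 ^ (K - k))%N ->
    laplace (path_terms k j) <= 4.
Proof.
move=> mass6.
have e2 l : laplace ((2, [ffun=> 1]) :: l) = 2 + laplace l.
  rewrite /laplace big_cons /= big1 ?mulr0 ?oppr0 ?expR0 ?mulr1// => t _.
  by rewrite ffunE subrr mulr0.
elim=> [|k IH] j kK jm; first by rewrite /= e2 /laplace big_nil; lra.
have jm2 : (m * 2 ^ (K - k) = (m * 2 ^ (K - k.+1)).*2)%N.
  by rewrite -muln2 -mulnA -expnSr; congr (_ * 2 ^ _)%N; lia.
rewrite [path_terms _ _]/= e2 laplace_join ?supported_path_terms//.
have IH1 := IH j.*2 (ltnW kK); have IH2 := IH j.*2.+1 (ltnW kK).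
have [] : (j.*2 < m * 2 ^ (K - k) /\ j.*2.+1 < m * 2 ^ (K - k))%N.
  by rewrite jm2; lia.
move=> /IH1 a4 /IH2 b4.
have a0 := laplace_ge0 _ (nonneg_path_terms k j.*2).
have b0 := laplace_ge0 _ (nonneg_path_terms k j.*2.+1).
have e0 : 0 <= expR (- (lam * node_mass k.+1 j / 2)) by exact: expR_ge0.
have e8 : expR (- (lam * node_mass k.+1 j / 2)) <= 8^-1.
  apply: le_trans expRN3_le; rewrite ler_expR.
  by have := mass6 k.+1 j; rewrite kK /= => /(_ isT jm); lra.
have ab : laplace (path_terms k j.*2) * laplace (path_terms k j.*2.+1) <= 4 * 4.
  exact: ler_pM.
have : laplace (path_terms k j.*2) * laplace (path_terms k j.*2.+1)
   * expR (- (lam * node_mass k.+1 j / 2)) <= (4 * 4) * 8^-1.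
  by apply: ler_pM => //; exact: mulr_ge0.
lra.
Qed.

Lemma expect_eval N l :
  \sum_(s : {ffun 'I_N -> T}) (\prod_i p (s i)) * eval_terms l (codom s) =
  \sum_(c <- l) c.1 * (\sum_t p t * c.2 t) ^+ N.
Proof.
under eq_bigr do rewrite /eval_terms big_distrr /=.
rewrite exchange_big /=; apply: eq_bigr => c _.
rewrite -[N in RHS]card_ord -prodr_const bigA_distr_bigA big_distrr /=.
apply: eq_bigr => s _.
by rewrite mulrCA big_split /= codomE big_map big_enum.
Qed.

(** Generating function of the Poisson law: q ^ N has mean exp (- lam (1 - q)). All terms are
    nonnegative, so a bound on partial sums is enough for the limit taken later. *)
Lemma poisson_expect_le l M : nonneg_terms l ->
  \sum_(0 <= N < M) (expR (- lam) * lam ^+ N / N`!%:R) *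
     (\sum_(c <- l) c.1 * (\sum_t p t * c.2 t) ^+ N) <= laplace l.
Proof.
move=> /allP nl; under eq_bigr do rewrite big_distrr /=.
rewrite exchange_big /= /laplace !big_seq; apply: ler_sum => c /nl /andP[c0 /forallP cw].
set q := \sum_t p t * c.2 t.
have q0 : 0 <= q by apply: sumr_ge0 => t _; rewrite mulr_ge0//; have /andP[] := cw t.
have -> : \sum_t p t * (1 - c.2 t) = 1 - q.
  by under eq_bigr do rewrite mulrBr mulr1; rewrite sumrB p_sum1.
have -> : expR (- (lam * (1 - q))) = expR (- lam) * expR (lam * q).
  by rewrite -expRD; congr expR; ring.
apply: (@le_trans _ _ (c.1 * expR (- lam) * \sum_(0 <= N < M) (lam * q) ^+ N / N`!%:R)).
  rewrite big_distrr /=; apply: ler_sum => N _.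
  by rewrite exprMn le_eqVlt; apply/orP; left; apply/eqP; ring.
rewrite -mulrA ler_wpM2l// ler_wpM2l ?expR_ge0//.
by apply: sum_exp_coeff_le; exact: mulr_ge0.
Qed.

End MultiplicativeFunctionals.

Lemma le_measure_fin_cover d (U : measurableType d) (R : realType)
    (mu : {measure set U -> \bar R}) (I : finType) (Q : pred I)
    (A : set U) (F : I -> set U) :
  measurable A -> (forall i, measurable (F i)) ->
  (forall w, A w -> exists2 i, Q i & F i w) ->
  (mu A <= \sum_(i | Q i) mu (F i))%E.
Proof.
move=> mA mF AF.
have mU (r : seq I) : measurable (\big[setU/set0]_(i <- r | Q i) F i).
  by apply: bigsetU_measurable.
apply: (@le_trans _ _ (mu (\big[setU/set0]_(i <- index_enum I | Q i) F i))).
  apply: le_measure; rewrite ?inE//.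
  move=> w /AF[i Qi Fi]; rewrite -bigcup_seq_cond.
  by exists i => //=; rewrite mem_index_enum.
elim: (index_enum I) => [|i r IH]; first by rewrite !big_nil measure0.
rewrite !big_cons; case: ifP => // _.
by apply: (le_trans (measureU2 _ _ _)) => //; exact: leeD2l.
Qed.

(** * Poisson samples with marks in a finite set *)

Section MarkedPoisson.
Variables (R : realType) (d d' : measure_display) (Omega : measurableType d).
Variables (S : measurableType d') (P : probability Omega R).
Variables (N : Omega -> nat) (X : nat -> Omega -> S).
Variables (T : finType) (mark : S -> T) (p : T -> R) (lam : R).
Hypothesis measurable_mark : forall t, measurable (mark @^-1` [set t]).
Hypothesis measurable_X : forall i, measurable_fun setT (X i).
Hypothesis measurable_N : forall k, measurable [set w | N w = k].
Hypothesis law_N : forall k, P [set w | N w = k] =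
  (expR (- lam) * lam ^+ k / (k`!)%:R)%:E.
Hypothesis law_X : forall i t, P (X i @^-1` (mark @^-1` [set t])) = (p t)%:E.
Hypothesis indep : forall k (I : seq nat) (B : nat -> set S), uniq I ->
  (forall i, measurable (B i)) ->
  P ([set w | N w = k] `&` [set w | forall i, i \in I -> B i (X i w)]) =
  (P [set w | N w = k] * \prod_(i <- I) P (X i @^-1` B i))%E.

Lemma measurable_preimage_X i (B : set S) :
  measurable B -> measurable (X i @^-1` B).
Proof. by move=> mB; rewrite -[X in measurable X]setTI; exact: measurable_X. Qed.

Lemma mark_ge0 t : 0 <= p t.
Proof. by rewrite -lee_fin -(law_X 0). Qed.

Lemma measurable_mark_seq (r : seq T) : measurable [set z | mark z \in r].
Proof.
elim: r => [|t r IH].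
  by rewrite (_ : [set _ | _] = set0)//; apply/seteqP; split.
rewrite (_ : [set _ | _] = mark @^-1` [set t] `|` [set z | mark z \in r]).
  exact: measurableU.
apply/seteqP; split => z /=; rewrite inE.
  by move=> /orP[/eqP|]; [left|right].
by move=> [->|->]; rewrite ?eqxx ?orbT.
Qed.

Lemma mass_mark_seq (r : seq T) : uniq r ->
  P (X 0 @^-1` [set z | mark z \in r]) = (\sum_(t <- r) p t)%:E.
Proof.
elim: r => [_|t r IH /= /andP[tr ur]].
  by rewrite big_nil (_ : _ @^-1` _ = set0) ?measure0//; apply/seteqP; split.
rewrite big_cons EFinD -IH// -(law_X 0) -measureU.
- congr (P _); apply/seteqP; split => w /=; rewrite inE.
    by move=> /orP[/eqP|]; [left|right].
  by move=> [->|->]; rewrite ?eqxx ?orbT.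
- exact/measurable_preimage_X/measurable_mark.
- exact/measurable_preimage_X/measurable_mark_seq.
- apply/seteqP; split => w //= [wt wr].
  by move: tr; rewrite -wt wr.
Qed.

Lemma mass_mark (Q : pred T) :
  P (X 0 @^-1` [set z | Q (mark z)]) = (\sum_(t | Q t) p t)%:E.
Proof.
rewrite -big_filter -mass_mark_seq ?filter_uniq ?index_enum_uniq//.
congr (P _); apply/seteqP; split => w /=; by rewrite mem_filter mem_index_enum andbT.
Qed.

Lemma sum_mark : \sum_t p t = 1.
Proof.
apply: EFin_inj; rewrite -(mass_mark predT) -(@probability_setT _ _ _ P).
by congr (P _); apply/seteqP.
Qed.

(** Hypothesis [indep] wants a family of sets indexed by all of [nat]; [insub] extends the first [k]
    of them by [setT]. *)
Definition mark_event k (s : {ffun 'I_k -> T}) : set Omega :=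
  [set w | N w = k] `&`
  [set w | forall i, i \in iota 0 k ->
     (if insub i is Some j then mark @^-1` [set s j] else setT) (X i w)].

Lemma prob_mark_event k (s : {ffun 'I_k -> T}) :
  P (mark_event k s) =
  (expR (- lam) * lam ^+ k / (k`!)%:R * \prod_i p (s i))%:E.
Proof.
rewrite /mark_event (indep k (iota 0 k) (fun i => if insub i is Some j
  then mark @^-1` [set s j] else setT)); last 2 first.
- exact: iota_uniq.
- by move=> i; case: insub => // j; exact: measurable_mark.
rewrite law_N [RHS]EFinM; congr (_ * _)%E.
rewrite -[k in iota 0 k]subn0 -/(index_iota 0 k) big_mkord.
rewrite (big_morph EFin (@EFinM R) erefl); apply: eq_bigr => i _.
by rewrite (_ : insub (nat_of_ord i) = Some i) ?law_X//; exact: valK.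
Qed.

Lemma measurable_mark_event k (s : {ffun 'I_k -> T}) :
  measurable (mark_event k s).
Proof.
apply: measurableI => //.
rewrite (_ : [set _ | _] = \bigcap_(i in [set` iota 0 k])
  X i @^-1` (if insub i is Some j then mark @^-1` [set s j] else setT)).
  apply: bigcap_measurableType => // i _.
  apply: measurable_preimage_X; case: insub => // j; exact: measurable_mark.
by apply/seteqP; split => w /= h i; exact: h.
Qed.

(** Markov's inequality by summation: [F] is split by the value of [N] and by the finitely many mark
    sequences. A sequence containing a null mark has probability 0; on the others the functional is
    at least 1 and may be inserted as a factor. *)
Lemma poisson_laplace_bound (F : set Omega) (l : seq (R * {ffun T -> R})) :
  0 <= lam -> measurable F -> nonneg_terms R T l ->
  (forall w, F w -> (exists2 i, (i < N w)%N & p (mark (X i w)) = 0) \/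
     1 <= eval_terms R T l [seq mark (X i w) | i <- iota 0 (N w)]) ->
  (P F <= (laplace R T p lam l)%:E)%E.
Proof.
move=> lam0 mF nl bad.
pose a k := expR (- lam) * lam ^+ k / (k`!)%:R.
have a0 k : 0 <= a k by rewrite /a divr_ge0// mulr_ge0 ?expR_ge0 ?exprn_ge0.
pose b k := a k * \sum_(c <- l) c.1 * (\sum_t p t * c.2 t) ^+ k.
have step k : (P (F `&` [set w | N w = k]) <= (b k)%:E)%E.
  pose good (s : {ffun 'I_k -> T}) :=
    [exists i, p (s i) == 0] || (1 <= eval_terms R T l (codom s)).
  apply: (le_trans (le_measure_fin_cover _ _ _ P _ good _ (mark_event k) _ _ _)).
  - exact: measurableI.
  - exact: measurable_mark_event.
  - move=> w [Fw /= Nw].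
    exists [ffun i : 'I_k => mark (X i w)]; last first.
      split => //= i _; case: insubP => //= j _ <-; by rewrite ffunE.
    apply/orP; case: (bad w Fw) => [[i]|h].
      rewrite Nw => ik pi0; left; apply/existsP; exists (Ordinal ik).
      by rewrite ffunE /= pi0.
    right; rewrite codomE (_ : [seq _ | _ <- _] =
      [seq mark (X i w) | i <- iota 0 (N w)])//.
    rewrite Nw -val_enum_ord -map_comp; apply: eq_map => i.
    exact: ffunE.
  rewrite /b -expect_eval big_distrr /= -sumEFin.
  rewrite [leRHS](bigID good) /=.
  rewrite -[leLHS]adde0; apply: leeD; last first.
    apply: sume_ge0 => s _; rewrite lee_fin; apply: mulr_ge0; first exact: a0.
    apply: mulr_ge0; last exact: eval_ge0.
    by apply: prodr_ge0 => i _; exact: mark_ge0.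
  apply: lee_sum => s /orP[/existsP[i /eqP pi0]|ev1]; rewrite prob_mark_event lee_fin.
    by rewrite (bigD1 i)//= pi0 !mul0r !mulr0 ?mul0r ?mulr0.
  rewrite mulrA ler_peMr//; apply: mulr_ge0; first exact: a0.
  by apply: prodr_ge0 => i _; exact: mark_ge0.
have b0 k : 0 <= b k by rewrite -lee_fin (le_trans _ (step k)).
apply: (@le_trans _ _ (\sum_(0 <= k <oo) P (F `&` [set w | N w = k]))%E).
  apply: measure_sigma_subadditive => // [k|w Fw]; first exact: measurableI.
  by exists (N w).
apply: (@le_trans _ _ (\sum_(0 <= k <oo) (b k)%:E)%E).
  by apply: lee_nneseries => // k _; exact: step.
apply: lime_le; first by apply: is_cvg_nneseries => k _ _; rewrite lee_fin.
apply: nearW => M; rewrite sumEFin lee_fin.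
apply: poisson_expect_le => //; [exact: mark_ge0|exact: sum_mark].
Qed.

End MarkedPoisson.

(** * Discretisation of the hyperbolic disk *)

Section Discretisation.
Variables (R : realType) (Rad : R) (K : nat).

(* A block of level k has angle 2 ^ k * block_angle, of square at most
   exp (- r) for each radius r <= Rad - k ln 4 when exp Rad <= 16 ^ K: its
   level-k points are adjacent to every point of the block of level <= k. *)
Definition block_angle : R := pi / (4 * 4 ^+ K).
(** The minimum gathers all radii up to Rad - K ln 4 into the top level. *)
Definition level (z : R * R) : nat :=
  minn K (Num.truncn ((Rad - z.1) / ln 4)).
(** Angles are counted downwards from 2 pi, which turns the range ]0, 2 pi] into [0, 2 pi[, as suits
    truncation. *)
Definition block (z : R * R) : nat :=
  Num.truncn ((2 * pi - z.2) / block_angle).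

(* None marks the points outside the disk, a null event; the block index
   8 * 4 ^ K is never attained and only makes inord available. *)
Definition cell := option ('I_K.+1 * 'I_(8 * 4 ^ K).+1)%type.
(** Level K + 1 keeps [None] out of all nodes and blocks of level at most K. *)
Definition cell_level (t : cell) : nat := if t is Some u then u.1 else K.+1.
Definition cell_block (t : cell) : nat := if t is Some u then u.2 else 0%N.
Definition mark (z : R * R) : cell :=
  if `[< diskR Rad z >] then Some (inord (level z), inord (block z)) else None.

Lemma ln4_gt0 : 0 < ln 4 :> R.
Proof. by rewrite ln_gt0//; lra. Qed.

Lemma block_angle_gt0 : 0 < block_angle.
Proof. by rewrite divr_gt0 ?pi_gt0// mulr_gt0 ?exprn_gt0. Qed.

Lemma block_lt z : diskR Rad z -> (block z < 8 * 4 ^ K)%N.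
Proof.
move=> [_ /andP[t0 t1]]; have w0 := block_angle_gt0.
have t_ge0 : 0 <= (2 * pi - z.2) / block_angle.
  by rewrite divr_ge0 ?(ltW w0)//; lra.
rewrite /block truncn_lt_nat//.
rewrite ltr_pdivrMr// natrM natrX.
have -> : 8 * 4 ^+ K * block_angle = 2 * pi.
  by rewrite /block_angle; field; rewrite expf_neq0.
lra.
Qed.

Lemma cell_level_mark z : diskR Rad z -> cell_level (mark z) = level z.
Proof.
move=> Dz; rewrite /mark asboolT//= inordK//.
by rewrite /level ltnS geq_minl.
Qed.

Lemma cell_block_mark z : diskR Rad z -> cell_block (mark z) = block z.
Proof.
move=> Dz; rewrite /mark asboolT//= inordK// ltnS.
exact/ltnW/block_lt.
Qed.

Lemma mark_None z : mark z = None -> ~ diskR Rad z.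
Proof. by rewrite /mark; case: asboolP. Qed.

Lemma level_radius z : diskR Rad z -> z.1 <= Rad - (level z)%:R * ln 4.
Proof.
move=> [/andP[_ /ltW r1] _].
rewrite lerBrDr addrC -lerBrDr -ler_pdivlMr ?ln4_gt0//.
rewrite -truncn_ge_nat ?geq_minr//.
by rewrite divr_ge0 ?(ltW ln4_gt0)// subr_ge0.
Qed.

Lemma same_block_angle z z' k : diskR Rad z -> diskR Rad z' ->
  (block z %/ 2 ^ k = block z' %/ 2 ^ k)%N ->
  (z.2 - z'.2) ^+ 2 <= (2 ^+ k * block_angle) ^+ 2.
Proof.
move=> Dz Dz' bb; have w0 := block_angle_gt0.
pose t (u : R * R) := (2 * pi - u.2) / block_angle.
have tb u : diskR Rad u ->
  (block u %/ 2 ^ k)%:R * 2 ^+ k <= t u < ((block u %/ 2 ^ k)%:R + 1) * 2 ^+ k.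
  move=> [_ /andP[u0 u1]].
  have tu0 : 0 <= t u by rewrite divr_ge0 ?(ltW w0)//; lra.
  have /andP[lo hi] := truncn_itv tu0.
  rewrite -/(block u) in lo hi; apply/andP; split.
    by apply: le_trans lo; rewrite -natrX -natrM ler_nat leq_trunc_div.
  apply: (lt_le_trans hi); rewrite natr1 -natrX -natrM ler_nat.
  by rewrite ltn_ceil// expn_gt0.
have /andP[a1 a2] := tb _ Dz; have /andP[b1 b2] := tb _ Dz'.
rewrite bb in a1 a2.
have -> : z.2 - z'.2 = (t z' - t z) * block_angle.
  by rewrite /t; field; rewrite gt_eqF.
have norm_le : `|t z' - t z| <= 2 ^+ k.
  by rewrite ler_norml; apply/andP; split; lra.
rewrite -[leLHS]real_normK ?num_real// normrM (gtr0_norm w0).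
apply: lerXn2r.
- by rewrite nnegrE mulr_ge0// ltW.
- by rewrite nnegrE mulr_ge0 ?exprn_ge0// ltW.
- by rewrite ler_pM2r.
Qed.

Variable y : R.
Hypotheses (y_ge1 : 1 <= y) (y_le : y <= 4 ^+ K) (RadE : Rad = 2 * ln y).

Let y_gt0 : 0 < y. Proof. exact: lt_le_trans ltr01 y_ge1. Qed.

Lemma same_block_adj z z' k : diskR Rad z -> diskR Rad z' ->
  level z = k -> (level z' <= k)%N ->
  (block z %/ 2 ^ k = block z' %/ 2 ^ k)%N -> hdist z z' <= Rad.
Proof.
move=> Dz Dz' lz lz' bb.
have rz := level_radius z Dz; rewrite lz in rz.
have small r : r <= Rad - k%:R * ln 4 ->
    (2 ^+ k * block_angle) ^+ 2 <= expR (- r).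
  move=> rk; apply: (@le_trans _ _ (expR (k%:R * ln 4 - Rad))); last first.
    by rewrite ler_expR; lra.
  rewrite expRB RadE !expRM_natl !lnK ?posrE//.
  have -> : (2 ^+ k * block_angle) ^+ 2 = 4 ^+ k * block_angle ^+ 2.
    by rewrite exprMn -exprM mulnC exprM; congr (_ ^+ k * _); rewrite -natrX.
  apply: ler_wpM2l; first by rewrite exprn_ge0.
  rewrite -exprVn lerXn2r ?nnegrE ?invr_ge0 ?(ltW y_gt0) ?(ltW block_angle_gt0)//.
  apply: (@le_trans _ _ (4 ^+ K)^-1); last by rewrite lef_pV2 ?posrE ?exprn_gt0.
  (* The factor 8 in the number of blocks leaves pi / 4 here, which is at most 1. *)
  rewrite /block_angle invfM mulrA ler_piMl ?invr_ge0 ?exprn_ge0//.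
  by have := pihalf_lt2 R; lra.
have ang := same_block_angle z z' k Dz Dz' bb.
case: (Dz) => /andP[z0 z1] _; case: (Dz') => /andP[z0' z1'] _.
(* The angular criterion involves the smaller radius, which in both cases is at most that of [z]. *)
have [h|/ltW h] := leP z.1 z'.1.
  apply: hdist_le_of_angle => //; first exact: ltW.
  by apply: (le_trans ang); exact: small.
rewrite hdistC; apply: hdist_le_of_angle => //; first exact: ltW.
rewrite -sqrrN opprB; apply: (le_trans ang); apply: small; exact: le_trans rz.
Qed.

Lemma top_level_adj z z' : diskR Rad z -> diskR Rad z' ->
  level z = K -> level z' = K -> hdist z z' <= Rad.
Proof.
move=> Dz Dz' lz lz'.
have := level_radius z Dz; have := level_radius z' Dz'; rewrite lz lz' => a b.
case: (Dz) => /andP[z0 z1] _; case: (Dz') => /andP[z0' z1'] _.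
apply: hdist_le_of_add => //.
have : ln y <= K%:R * ln 4.
  rewrite mulr_natl -lnXn//; first by rewrite ler_ln ?posrE ?exprn_gt0.
by have := RadE; lra.
Qed.

Lemma hamiltonian_of_counts (x : nat -> R * R) (N k : nat) : K = k.+1 ->
  (forall i, (i < N)%N -> diskR Rad (x i)) ->
  let s := [seq mark (x i) | i <- iota 0 N] in
  let cnt k j := count (at_node cell_level cell_block k j) s in
  (forall j, (j < 8 * 2 ^ K)%N ->
    (paths_bound cnt k j.*2 + paths_bound cnt k j.*2.+1 < cnt k.+1 j)%N) ->
  hamiltonian Rad N x.
Proof.
move=> Kk Dx s cnt enough.
pose lv i := cell_level (mark (x i)); pose bx i := cell_block (mark (x i)).
have cntE : cnt = node_count lv bx N.
  by apply/funext => a; apply/funext => b; rewrite /cnt /s count_map.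
apply: (@dyadic_hamilton_cycle lv bx (hadj Rad x) N K _ _ _ k (8 * 2 ^ K)) => //.
- exact: hadj_sym.
- move=> i i' a iN iN' ii' aK; rewrite /lv /bx.
  rewrite !cell_level_mark ?cell_block_mark; try exact: Dx.
  by move=> *; rewrite /hadj ii' /=; apply: (@same_block_adj _ _ a) => //; exact: Dx.
- move=> i i' iN iN' ii'; rewrite /lv !cell_level_mark; try exact: Dx.
  by move=> *; rewrite /hadj ii' /=; apply: top_level_adj => //; exact: Dx.
- by have := expn_gt0 2 K; lia.
- by move=> i iN; rewrite /lv cell_level_mark ?geq_minl//; exact: Dx.
- move=> i iN; rewrite /bx cell_block_mark; last exact: Dx.
  by rewrite -mulnA -expnMn; apply: block_lt; exact: Dx.
- by rewrite -cntE.
Qed.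

End Discretisation.

(** * Measurability of the marks and of the Hamiltonian event *)

Section Measurability.
Variable R : realType.

Lemma measurable_truncn d (U : measurableType d) (g : U -> R) (k : nat) :
  measurable_fun setT g -> measurable [set u | Num.truncn (g u) = k].
Proof.
move=> mg.
have le_m l : measurable [set u | (Num.truncn (g u) <= l)%N].
  rewrite (_ : [set u | _] = g @^-1` `]-oo, l.+1%:R[).
    by rewrite -[X in measurable X]setTI; exact: mg.
  by apply/seteqP; split => u /=; rewrite in_itv /= truncn_le_nat.
case: k => [|k].
  rewrite (_ : [set u | _] = [set u | (Num.truncn (g u) <= 0)%N])//.
  by apply/seteqP; split => u /=; rewrite leqn0 => /eqP.
rewrite (_ : [set u | _] = [set u | (Num.truncn (g u) <= k.+1)%N] `\`
                           [set u | (Num.truncn (g u) <= k)%N]).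
  exact: measurableD.
apply/seteqP; split => u /=; first by move=> ->; rewrite leqnn ltnn.
by move=> [h1 h2]; apply/eqP; rewrite eqn_leq h1 ltnNge; apply/negP.
Qed.

Lemma measurable_diskR (Rad : R) : measurable (diskR Rad).
Proof.
rewrite (_ : diskR Rad = `[0, Rad[ `*` `]0, 2 * pi]); first exact: measurableX.
by apply/seteqP; split => z /=; rewrite !in_itv.
Qed.

Lemma measurable_mark (Rad : R) K (t : cell K) :
  measurable (mark R Rad K @^-1` [set t]).
Proof.
pose G (D : bool) l b : cell K :=
  if D then Some (inord (minn K l), inord b) else None.
pose tl (z : R * R) := Num.truncn ((Rad - z.1) / ln 4).
pose tb (z : R * R) := Num.truncn ((2 * pi - z.2) / block_angle R K).
have mtl l : measurable [set z | tl z = l].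
  apply: measurable_truncn; apply: measurable_funM => //.
  by apply: measurable_funB => //; exact: measurable_fst.
have mtb b : measurable [set z | tb z = b].
  apply: measurable_truncn; apply: measurable_funM => //.
  by apply: measurable_funB => //; exact: measurable_snd.
(* The mark depends only on two integers and on membership in the disk, so its fibres are countable
   unions of measurable sets. *)
rewrite (_ : _ @^-1` _ = \bigcup_l \bigcup_b
  ([set z | tl z = l] `&` [set z | tb z = b] `&`
   [set z | G `[< diskR Rad z >] l b = t])); last first.
  apply/seteqP; split => z /=.
    by move=> <-; exists (tl z) => //; exists (tb z).
  by move=> [l _ [b _ [[<- <-] <-]]].
apply: bigcupT_measurable => l; apply: bigcupT_measurable => b.
apply: measurableI; first exact: measurableI.
have mD := measurable_diskR Rad.
rewrite (_ : [set z | _] =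
   (diskR Rad `&` [set z | G true l b = t]) `|`
   (~` diskR Rad `&` [set z | G false l b = t])).
  have mc (Q : Prop) : measurable [set z : R * R | Q].
    have [q|q] := pselect Q.
      rewrite (_ : [set _ | _] = setT); first exact: measurableT.
      by apply/seteqP; split.
    rewrite (_ : [set _ | _] = set0); first exact: measurable0.
    by apply/seteqP; split.
  by apply: measurableU; apply: measurableI => //; exact: measurableC.
apply/seteqP; split => z /=.
  by case: asboolP => Dz h; [left|right].
by move=> [[Dz h]|[Dz h]]; [rewrite asboolT|rewrite asboolF].
Qed.

Lemma measurable_hdist d (U : measurableType d) (f g : U -> R * R) :
  measurable_fun setT f -> measurable_fun setT g ->
  measurable_fun setT (fun u => hdist (f u) (g u)).
Proof.
move=> mf mg.
have m1 h : measurable_fun setT h -> measurable_fun setT (fun u : U => (h u : R * R).1).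
  by move=> mh; apply: measurableT_comp => //; exact: measurable_fst.
have m2 h : measurable_fun setT h -> measurable_fun setT (fun u : U => (h u : R * R).2).
  by move=> mh; apply: measurableT_comp => //; exact: measurable_snd.
have mexp h : measurable_fun setT h -> measurable_fun setT (fun u : U => expR (h u : R)).
  by move=> mh; apply: (measurableT_comp (@measurable_expR R)).
have mexpN h : measurable_fun setT h -> measurable_fun setT (fun u : U => expR (- (h u : R))).
  by move=> mh; apply: mexp; exact: measurable_funN.
have mcosh h : measurable_fun setT h -> measurable_fun setT (fun u : U => coshR (h u : R)).
  move=> mh; apply: measurable_funM => //.
  by apply: measurable_funD; [exact: mexp|exact: mexpN].
have msinh h : measurable_fun setT h -> measurable_fun setT (fun u : U => sinhR (h u : R)).
  move=> mh; apply: measurable_funM => //.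
  by apply: measurable_funB; [exact: mexp|exact: mexpN].
have macosh h : measurable_fun setT h -> measurable_fun setT (fun u : U => acoshR (h u : R)).
  move=> mh; apply: (measurableT_comp (@measurable_ln R)).
  apply: measurable_funD => //.
  apply: (measurableT_comp (continuous_measurable_fun (@sqrt_continuous R))).
  apply: measurable_funB => //; exact: measurable_funX.
apply: macosh; apply: measurable_funB.
  by apply: measurable_funM; apply: mcosh; apply: m1.
apply: measurable_funM.
  by apply: measurable_funM; apply: msinh; apply: m1.
apply: (measurableT_comp (continuous_measurable_fun (@continuous_cos R))).
by apply: measurable_funB; apply: m2.
Qed.

Section HamiltonianEvent.
Variables (d : measure_display) (Omega : measurableType d).
Variables (N : Omega -> nat) (X : nat -> Omega -> R * R) (Rad : R).
Hypothesis measurable_X : forall i, measurable_fun setT (X i).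
Hypothesis measurable_N : forall k, measurable [set w | N w = k].

Lemma measurable_hadj i j :
  measurable [set w | hadj Rad (fun i => X i w) i j].
Proof.
rewrite /hadj; case: eqP => /= ij.
  by rewrite (_ : [set w | _] = set0)//; apply/seteqP; split.
rewrite (_ : [set w | _] = (fun w => hdist (X i w) (X j w)) @^-1` `]-oo, Rad]).
  rewrite -[X in measurable X]setTI.
  exact: (measurable_hdist _ _ (X i) (X j)).
by apply/seteqP; split => w /=; rewrite in_itv.
Qed.

Lemma measurable_path c q :
  measurable [set w | path (hadj Rad (fun i => X i w)) c q].
Proof.
elim: q c => [|c' q IH] c /=.
  by rewrite (_ : [set w | _] = setT)//; apply/seteqP; split.
rewrite (_ : [set w | _] = [set w | hadj Rad (fun i => X i w) c c'] `&`
  [set w | path (hadj Rad (fun i => X i w)) c' q]).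
  by apply: measurableI => //; exact: measurable_hadj.
by apply/seteqP; split => w /= /andP.
Qed.

Lemma measurable_not_hamiltonian :
  measurable [set w | ~ hamiltonian Rad (N w) (fun i => X i w)].
Proof.
suff mH : measurable [set w | hamiltonian Rad (N w) (fun i => X i w)].
  exact: measurableC mH.
rewrite (_ : [set w | _] = \bigcup_k ([set w | N w = k] `&`
  (if (3 <= k)%N then \bigcup_(s in [set` permutations (iota 0 k)])
     [set w | cycle (hadj Rad (fun i => X i w)) s] else set0))).
  apply: bigcupT_measurable => k; apply: measurableI => //.
  case: ifP => // _; apply: fin_bigcup_measurable => // -[|c q] _ /=.
    by rewrite (_ : [set w | _] = setT)//; apply/seteqP; split.
  exact: measurable_path.
apply/seteqP; split => w /=.
  move=> [N3 [s [ps cs]]]; exists (N w) => //; split => //.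
  rewrite N3; exists s => //=; by rewrite mem_permutations.
move=> [k _ [/= <-]]; case: ifP => // N3 [s /=].
by rewrite mem_permutations => ps cs; split => //; exists s.
Qed.

End HamiltonianEvent.
End Measurability.

(** * Lower bounds for the mass of a node *)

Section CellMass.
Variables (R : realType) (alpha : R).
Hypothesis alpha_gt0 : 0 < alpha.

Lemma sinhR_ge0 (x : R) : 0 <= x -> 0 <= sinhR x.
Proof. by move=> x0; rewrite /sinhR divr_ge0// subr_ge0 ler_expR; lra. Qed.

Lemma ler_sinhR (x y : R) : x <= y -> sinhR x <= sinhR y.
Proof.
move=> xy; rewrite /sinhR ler_pM2r ?invr_gt0//.
by rewrite lerB// ler_expR// lerN2.
Qed.

Lemma coshR_ge1 (x : R) : 1 <= coshR x.
Proof.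
rewrite /coshR expRN; have x0 := expR_gt0 x; move: (expR x) x0 => a a0.
rewrite -subr_ge0 (_ : _ - 1 = (a - 1) ^+ 2 / (2 * a)); last first.
  by field; rewrite gt_eqF.
by rewrite divr_ge0 ?sqr_ge0// mulr_ge0// ltW.
Qed.

Lemma f_alpha_denom_ge0 (Rad : R) :
  0 <= 2 * pi * (coshR (alpha * Rad) - 1).
Proof. by rewrite !mulr_ge0 ?pi_ge0// subr_ge0 coshR_ge1. Qed.

(** The density increases with the radius, so its value at the inner edge bounds it below. *)
Lemma dens_rect_ge (Rad r0 r1 t0 t1 : R) :
  0 <= r0 -> r0 < r1 -> r1 <= Rad -> 0 <= t0 -> t0 < t1 -> t1 <= 2 * pi ->
  ((f_alpha alpha Rad (r0, 0) * ((r1 - r0) * (t1 - t0)))%:E <=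
   \int[(@lebesgue_measure R) \x (@lebesgue_measure R)]_(z in
      (`]r0, r1[ `*` `]t0, t1])%classic) (dens alpha Rad z)%:E)%E.
Proof.
move=> r00 r01 r1R t00 t01 t1pi.
set D := (_ `*` _)%classic.
have mD : measurable D by apply: measurableX.
have DD z : D z -> diskR Rad z /\ r0 <= z.1.
  rewrite /D /= !in_itv /= => -[/andP[a b] /andP[c e]].
  rewrite /diskR /=; split; last exact: ltW.
  split; apply/andP; split; lra.
have -> : (\int[(@lebesgue_measure R) \x (@lebesgue_measure R)]_(z in D)
      (dens alpha Rad z)%:E =
    \int[(@lebesgue_measure R) \x (@lebesgue_measure R)]_(z in D)
      (f_alpha alpha Rad z)%:E)%E.
  apply: eq_integral => z /[1!inE] /DD[Dz _].
  by rewrite /dens asboolT.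
rewrite EFinM.
have -> : ((r1 - r0) * (t1 - t0))%:E =
    ((@lebesgue_measure R) \x (@lebesgue_measure R))%E D.
  rewrite /D product_measure1E//= !lebesgue_measure_itv /= !lte_fin r01 t01.
  by rewrite -!EFinD EFinM.
rewrite -integral_cst//.
apply: ge0_le_integral => //.
- move=> z _; rewrite lee_fin divr_ge0 ?f_alpha_denom_ge0//.
  apply: mulr_ge0; first exact: ltW.
  by apply: sinhR_ge0; apply: mulr_ge0 => //; exact: ltW.
- apply/measurable_EFinP; apply: measurable_funTS.
  apply: measurable_funM => //; apply: measurable_funM => //.
  have mf : measurable_fun setT (fun z : R * R => alpha * z.1).
    by apply: measurable_funM => //; exact: measurable_fst.
  rewrite /sinhR; apply: measurable_funM => //; apply: measurable_funB.
    exact: (measurableT_comp (@measurable_expR R)).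
  by apply: (measurableT_comp (@measurable_expR R)); exact: measurable_funN.
- move=> z /DD[_ rz]; rewrite lee_fin /f_alpha /= ler_wpM2r ?invr_ge0 ?f_alpha_denom_ge0//.
  by rewrite ler_wpM2l ?(ltW alpha_gt0)// ler_sinhR// ler_wpM2l// ltW.
Qed.

Variables (y : R) (K : nat).
Hypotheses (y_ge1 : 1 < y) (y_le : y <= 4 ^+ K) (y_ge : 4 ^+ K <= 4 * y).
Hypothesis alpha_lt : alpha < 1 / 2.
Hypothesis K_large : 1 <= 4 * alpha * (K%:R - 3).
Let Rad := 2 * ln y.

(** For k < K this is the whole node; for k = K only the outermost layer of the top level, which
    carries enough mass. *)
Definition cell_rect k j : set (R * R) :=
  `]Rad - k.+1%:R * ln 4, Rad - k%:R * ln 4[ `*`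
  `]2 * pi - j.+1%:R * (2 ^+ k * block_angle R K),
    2 * pi - j%:R * (2 ^+ k * block_angle R K)].

(** The 16 collects sinh >= exp / 4, cosh - 1 <= exp / 2, the radial width ln 4 >= 1 and the angle 2
    ^ k * pi / (4 * 4 ^ K). *)
Definition cell_rect_mass k : R :=
  alpha * 2 ^+ k * expR (- (alpha * k.+1%:R * ln 4)) / (16 * 4 ^+ K).

Let y_gt0 : 0 < y. Proof. exact: lt_trans ltr01 y_ge1. Qed.

Let ln4E : ln 4 = 2 * ln 2 :> R.
Proof. by rewrite (_ : 4 = 2 ^+ 2 :> R) ?lnXn// ?mulr_natl// -natrX. Qed.

Let ln4_gt1 : 1 <= ln 4 :> R.
Proof.
rewrite ln4E.
have : 1 - 2^-1 <= ln 2 :> R.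
  have := expR_ge1Dx (- ln 2 : R); rewrite expRN lnK ?posrE//; lra.
lra.
Qed.

Lemma log_y_ge : (K%:R - 1) * ln 4 <= ln y.
Proof.
have : ln (4 ^+ K) <= ln (4 * y) :> R by rewrite ler_ln ?posrE ?exprn_gt0 ?mulr_gt0.
by rewrite lnXn// lnM ?posrE// -mulr_natl; lra.
Qed.

(** As 4 ^ K <= 4 y, Rad is at least 2 (K - 1) ln 4, and at most K + 1 layers are removed. *)
Lemma inner_radius_ge k : (k <= K)%N ->
  (K%:R - 3) * ln 4 <= Rad - k.+1%:R * ln 4.
Proof.
move=> kK; have := log_y_ge; rewrite /Rad -[k.+1%:R]natr1.
have : k%:R * ln 4 <= K%:R * ln 4 :> R.
  by rewrite ler_wpM2r ?ler_nat// ?(le_trans ler01 ln4_gt1).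
lra.
Qed.

Lemma inner_radius_gt0 k : (k <= K)%N -> 0 <= Rad - k.+1%:R * ln 4.
Proof.
move=> kK; apply: le_trans (inner_radius_ge k kK).
rewrite mulr_ge0//; last exact: le_trans ler01 ln4_gt1.
by have := K_large; have := alpha_gt0; nra.
Qed.

Lemma block_row_le k j : (k <= K)%N -> (j < 8 * 2 ^ K * 2 ^ (K - k))%N ->
  j.+1%:R * (2 ^+ k * block_angle R K) <= 2 * pi.
Proof.
move=> kK jm; have w0 := block_angle_gt0 R K.
have -> : 2 * pi =
    (8 * 2 ^ K * 2 ^ (K - k))%:R * (2 ^+ k * block_angle R K).
  rewrite mulrA -[2 ^+ k]natrX -natrM -!mulnA -expnD subnK// -expnMn.
  by rewrite natrM natrX /block_angle; field; rewrite expf_neq0.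
by rewrite ler_pM2r ?ler_nat// mulr_gt0 ?exprn_gt0.
Qed.

Lemma cell_rect_mass_le k j : (k <= K)%N -> (j < 8 * 2 ^ K * 2 ^ (K - k))%N ->
  ((cell_rect_mass k)%:E <=
   \int[(@lebesgue_measure R) \x (@lebesgue_measure R)]_(z in cell_rect k j)
     (dens alpha Rad z)%:E)%E.
Proof.
move=> kK jm.
have w0 := block_angle_gt0 R K.
set w := 2 ^+ k * block_angle R K.
have w_gt0 : 0 < w by rewrite mulr_gt0 ?exprn_gt0.
have r0 := inner_radius_gt0 k kK.
have jw := block_row_le k j kK jm; rewrite -/w in jw.
apply: le_trans (dens_rect_ge _ _ _ _ _ _ _ _ _ _ _); rewrite ?lee_fin//.
- rewrite (_ : Rad - k%:R * ln 4 - (Rad - k.+1%:R * ln 4) = ln 4);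
    last by rewrite -[k.+1%:R]natr1; ring.
  rewrite (_ : 2 * pi - j%:R * w - (2 * pi - j.+1%:R * w) = w);
    last by rewrite -[j.+1%:R]natr1; ring.
  rewrite /f_alpha /= /cell_rect_mass.
  set r := Rad - _ in r0 *.
  (* This is what [K_large] provides: away from the origin the negative exponential in sinh costs at
     most half of the positive one. *)
  have e2 : 2 <= expR (2 * (alpha * r)).
    rewrite -[leLHS]lnK ?posrE// ler_expR.
    have := inner_radius_ge k kK; rewrite -/r => hr.
    have : 2 * alpha * ((K%:R - 3) * ln 4) <= 2 * alpha * r.
      by rewrite ler_wpM2l// mulr_ge0// ltW.
    have : 1 * ln 4 <= 4 * alpha * (K%:R - 3) * ln 4.
      by rewrite ler_wpM2r// (le_trans ler01 ln4_gt1).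
    by rewrite ln4E; lra.
  have sinh_ge : expR (alpha * r) / 4 <= sinhR (alpha * r).
    rewrite /sinhR expRN.
    have a0 := expR_gt0 (alpha * r).
    rewrite mulr2n mulrDl mul1r expRD in e2.
    move: (expR (alpha * r)) a0 e2 => a a0 e2.
    have : a^-1 <= a / 2 by rewrite -div1r ler_pdivrMr//; lra.
    lra.
  have aR : 0 < alpha * Rad by rewrite mulr_gt0// /Rad mulr_gt0// ln_gt0.
  have cosh_le : coshR (alpha * Rad) - 1 <= expR (alpha * Rad) / 2.
    have : expR (- (alpha * Rad)) <= 1 by rewrite expR_le1; lra.
    rewrite /coshR; lra.
  have cosh_gt : 0 < coshR (alpha * Rad) - 1.
    rewrite /coshR expRN.
    have a1 : 1 < expR (alpha * Rad) by rewrite expR_gt1.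
    move: (expR (alpha * Rad)) a1 => a a1.
    rewrite (_ : _ - 1 = (a - 1) ^+ 2 / (2 * a)); last by field; rewrite gt_eqF; lra.
    by rewrite divr_gt0 ?exprn_gt0 ?mulr_gt0//; lra.
  have -> : expR (- (alpha * k.+1%:R * ln 4)) =
      expR (alpha * r) / expR (alpha * Rad).
    by rewrite -expRB; congr expR; rewrite /r; ring.
  set A := expR (alpha * r) in sinh_ge *.
  set B := expR (alpha * Rad) in cosh_le *.
  have A0 : 0 < A by exact: expR_gt0.
  have B0 : 0 < B by exact: expR_gt0.
  have pi0 := pi_gt0 R.
  apply: (@le_trans _ _ (alpha * (A / 4) / (2 * pi * (B / 2)) * (1 * w))).
    rewrite le_eqVlt; apply/orP; left; apply/eqP.
    rewrite /w /block_angle; generalize (@pi R) pi0 => q q0; field.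
    by rewrite !gt_eqF ?exprn_gt0.
  apply: ler_pM.
  + by rewrite divr_ge0 ?mulr_ge0 ?divr_ge0 ?ltW.
  + by rewrite mul1r ltW.
  + apply: ler_pM.
    * by rewrite mulr_ge0 ?divr_ge0 ?ltW.
    * by rewrite invr_ge0 ?mulr_ge0 ?divr_ge0 ?ltW.
    * by rewrite ler_wpM2l// ltW.
    * by rewrite lef_pV2 ?posrE ?mulr_gt0 ?divr_gt0// ler_wpM2l// mulr_ge0// ltW.
  + by rewrite ler_wpM2r// ltW.
- by rewrite ltrD2l ltrN2 ltr_pM2r ?ltr_nat// ln4_gt0.
- by rewrite lerBlDr lerDl mulr_ge0// (le_trans ler01 ln4_gt1).
- by rewrite subr_ge0.
- by rewrite ltrD2l ltrN2 ltr_pM2r ?ltr_nat.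
- by rewrite lerBlDr lerDl mulr_ge0// ltW.
Qed.

Lemma cell_rect_sub k j z : (k <= K)%N -> (j < 8 * 2 ^ K * 2 ^ (K - k))%N ->
  cell_rect k j z ->
  at_node (cell_level K) (cell_block K) k j (mark R Rad K z).
Proof.
move=> kK jm; rewrite /cell_rect /=.
have w0 := block_angle_gt0 R K.
set w := 2 ^+ k * block_angle R K.
have w_gt0 : 0 < w by rewrite mulr_gt0 ?exprn_gt0.
rewrite !in_itv /= => -[/andP[r_lo r_hi] /andP[t_lo t_hi]].
have r0 := inner_radius_gt0 k kK.
have jw := block_row_le k j kK jm; rewrite -/w in jw.
have l0 : 0 < ln 4 :> R by exact: ln4_gt0.
have kl : 0 <= k%:R * ln 4 :> R by rewrite mulr_ge0// ltW.
have jw0 : 0 <= j%:R * w by rewrite mulr_ge0// ltW.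
have Dz : diskR Rad z by split; apply/andP; split; lra.
rewrite /at_node cell_level_mark// cell_block_mark//; apply/andP; split.
  apply/eqP; rewrite /level (@truncn_def _ _ k); first exact/minn_idPr.
  rewrite ler_pdivlMr// ltr_pdivrMr//; apply/andP; split; lra.
have u_ge : j%:R * 2 ^+ k <= (2 * pi - z.2) / block_angle R K.
  by rewrite ler_pdivlMr// -mulrA -/w; lra.
have u_lt : (2 * pi - z.2) / block_angle R K < j.+1%:R * 2 ^+ k.
  by rewrite ltr_pdivrMr// -mulrA -/w; lra.
have u0 : 0 <= (2 * pi - z.2) / block_angle R K.
  by apply: le_trans u_ge; rewrite mulr_ge0 ?exprn_ge0.
rewrite eqn_leq leq_divRL ?expn_gt0// -ltnS ltn_divLR ?expn_gt0//.
by rewrite /block truncn_ge_nat// truncn_lt_nat// !natrM !natrX u_ge u_lt.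
Qed.

(** Here 128 = 16 * 4 * 2: the 16 of [cell_rect_mass], y >= 4 ^ K / 4, and 4 ^ (- alpha) >= 1 /
    2. *)
Lemma cell_rect_mass_ge nu k : 0 < nu ->
  nu * alpha / 128 * expR ((1 - 2 * alpha) * (k%:R * ln 2)) <=
  nu * y * cell_rect_mass k.
Proof.
move=> nu0; rewrite /cell_rect_mass.
have -> : expR (- (alpha * k.+1%:R * ln 4)) =
    expR (- (2 * alpha * (k%:R * ln 2))) * expR (- (alpha * ln 4)).
  by rewrite -expRD -[k.+1%:R]natr1 ln4E; congr expR; ring.
have -> : expR ((1 - 2 * alpha) * (k%:R * ln 2)) =
    2 ^+ k * expR (- (2 * alpha * (k%:R * ln 2))).
  rewrite mulrBl mul1r expRD; congr (_ * _).
  by rewrite expRM_natl lnK ?posrE.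
set E := expR (- (2 * alpha * (k%:R * ln 2))).
have E0 : 0 <= E by exact: expR_ge0.
have half : 2^-1 <= expR (- (alpha * ln 4)).
  rewrite -[leLHS]lnK ?posrE ?invr_gt0// ler_expR lnV ?posrE// ln4E lerN2.
  have : 0 < ln 2 :> R by rewrite ln_gt0//; lra.
  by move: alpha_lt; nra.
apply: (@le_trans _ _ (nu * (4 ^+ K / 4) * (alpha * 2 ^+ k * (E * 2^-1) / (16 * 4 ^+ K)))).
  rewrite le_eqVlt; apply/orP; left; apply/eqP; field.
  by rewrite gt_eqF ?exprn_gt0.
have a0 := ltW alpha_gt0; have n0 := ltW nu0.
apply: ler_pM.
- by rewrite !mulr_ge0 ?exprn_ge0.
- by rewrite divr_ge0 ?mulr_ge0 ?exprn_ge0.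
- by rewrite ler_wpM2l// ler_pdivrMr// mulrC.
- rewrite ler_wpM2r ?invr_ge0 ?mulr_ge0 ?exprn_ge0//.
  rewrite ler_wpM2l ?mulr_ge0 ?exprn_ge0//.
  by rewrite ler_wpM2l.
Qed.

End CellMass.

(** * Failure probability *)

Section FailureProbability.
Variables (R : realType) (alpha nu : R) (n k : nat).
Variables (d : measure_display) (Omega : measurableType d).
Variables (P : probability Omega R) (N : Omega -> nat).
Variables (X : nat -> Omega -> R * R).
Local Notation K := k.+1.
Local Notation Rad := (kp_radius nu n).
Local Notation y := (n%:R / nu).
Hypotheses (alpha_gt0 : 0 < alpha) (alpha_lt : alpha < 1 / 2).
Hypotheses (nu_gt0 : 0 < nu) (nu_large : 768 <= nu * alpha).
Hypotheses (y_gt1 : 1 < y) (y_le : y <= 4 ^+ K) (y_ge : 4 ^+ K <= 4 * y).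
Hypothesis K_large : 1 <= 4 * alpha * (K%:R - 3).
Hypothesis model : is_KPKVB_poisson P alpha nu n N X.

Let T : finType := cell K.
Let mk : R * R -> T := mark R Rad K.
Let node := at_node (cell_level K) (cell_block K).

Definition cell_prob (t : T) : R := fine (P (X 0 @^-1` (mk @^-1` [set t]))).

Let measurable_N : forall j, measurable [set w | N w = j].
Proof. by case: model. Qed.

Let measurable_X : forall i, measurable_fun setT (X i).
Proof. by case: model => _ []. Qed.

Let law i (B : set (R * R)) : measurable B ->
  P (X i @^-1` B) = (\int[(@lebesgue_measure R) \x (@lebesgue_measure R)]_(z in B)
        (dens alpha Rad z)%:E)%E.
Proof. by case: model => _ [_ [_ [h _]]]; exact: h. Qed.

Let measurable_pre i (B : set (R * R)) : measurable B -> measurable (X i @^-1` B).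
Proof. exact: measurable_preimage_X. Qed.

Lemma cell_probE i t : P (X i @^-1` (mk @^-1` [set t])) = (cell_prob t)%:E.
Proof.
have mm : measurable (mk @^-1` [set t]) by exact: measurable_mark.
rewrite /cell_prob fineK; last exact/fin_num_measure/measurable_pre.
by rewrite !law.
Qed.

Lemma cell_prob_None : cell_prob None = 0.
Proof.
apply: EFin_inj; rewrite -(cell_probE 0) law; last exact: measurable_mark.
apply: integral0_eq => z /= /mark_None Dz.
by rewrite /dens asboolF.
Qed.

Lemma node_mass_ge a j : (a <= K)%N -> (j < 8 * 2 ^ K * 2 ^ (K - a))%N ->
  nu * alpha / 128 * expR ((1 - 2 * alpha) * (a%:R * ln 2)) <=
  n%:R * node_mass R T (cell_level K) (cell_block K) cell_prob a j.
Proof.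
move=> aK jm.
apply: (le_trans (cell_rect_mass_ge _ _ alpha_gt0 _ _ y_ge alpha_lt nu a nu_gt0)).
rewrite (_ : nu * y = n%:R); last by field; rewrite gt_eqF.
rewrite ler_wpM2l// -lee_fin.
apply: (le_trans (cell_rect_mass_le _ _ alpha_gt0 _ _ y_gt1 y_ge K_large a j aK jm)).
have mrect : measurable (cell_rect R y K a j) by exact: measurableX.
rewrite -(law 0 _ mrect) /node_mass.
have mark_mass := mass_mark _ _ _ _ _ P X T mk cell_prob
  (measurable_mark _ _ _) measurable_X cell_probE.
rewrite -mark_mass.
apply: le_measure; rewrite ?inE; first exact: measurable_pre.
  have := measurable_mark_seq _ _ T mk (measurable_mark _ _ _)
    [seq t <- index_enum T | node a j t].
  move=> h; rewrite (_ : _ @^-1` _ = X 0 @^-1` [set z | mk z \in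
    [seq t <- index_enum T | node a j t]]); first exact: measurable_pre.
  by apply/seteqP; split => w /=; rewrite mem_filter mem_index_enum andbT.
move=> w; exact: (cell_rect_sub _ _ alpha_gt0 _ _ y_gt1 y_ge K_large).
Qed.

(** Unlike in [path_terms], no constant 2 is added: a top block fails when L <= a + b, where 2 ^ (a
    + b - L) is already at least 1, and this functional alone has a tiny mean. *)
Definition top_terms j : seq (R * {ffun T -> R}) :=
  join_terms R T (cell_level K) (cell_block K)
    (path_terms R T (cell_level K) (cell_block K) k j.*2)
    (path_terms R T (cell_level K) (cell_block K) k j.*2.+1) K j.

(** The union bound over the top blocks, as a sum of functionals. *)
Definition all_top_terms : seq (R * {ffun T -> R}) :=
  flatten [seq top_terms j | j <- iota 0 (8 * 2 ^ K)].

Lemma nonneg_top_terms j : nonneg_terms R T (top_terms j).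
Proof. by apply: nonneg_join; exact: nonneg_path_terms. Qed.

Lemma nonneg_all_top_terms : nonneg_terms R T all_top_terms.
Proof.
apply/allP => c /flattenP[l /mapP[j _ ->] cl].
exact: (allP (nonneg_top_terms j)).
Qed.

Lemma eval_all_top_terms_ge j s : (j < 8 * 2 ^ K)%N ->
  eval_terms R T (top_terms j) s <= eval_terms R T all_top_terms s.
Proof.
move=> jm; rewrite [leRHS]/eval_terms /all_top_terms big_flatten big_map.
rewrite (bigD1_seq j) ?iota_uniq ?mem_iota//= lerDl.
by apply: sumr_ge0 => i _; exact: (eval_ge0 R T _ s (nonneg_top_terms i)).
Qed.

Lemma bad_event w : ~ hamiltonian Rad (N w) (fun i => X i w) ->
  (exists2 i, (i < N w)%N & cell_prob (mk (X i w)) = 0) \/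
  1 <= eval_terms R T all_top_terms [seq mk (X i w) | i <- iota 0 (N w)].
Proof.
move=> nham.
have [[i iN out]|inside] := pselect (exists2 i, (i < N w)%N & ~ diskR Rad (X i w)).
  by left; exists i => //; rewrite /mk /mark asboolF// cell_prob_None.
right; set s := [seq _ | _ <- _].
pose cnt a j := count (node a j) s.
have [j jm bad] : exists2 j, (j < 8 * 2 ^ K)%N &
    (cnt K j <= paths_bound cnt k j.*2 + paths_bound cnt k j.*2.+1)%N.
  apply: contrapT => allgood; apply: nham.
  apply: (hamiltonian_of_counts R Rad K y _ y_le _ _ _ k) => //.
  - exact: ltW.
  - by move=> i iN; apply: contrapT => out; apply: inside; exists i.
  - move=> j jm; rewrite ltnNge; apply/negP => le_j; apply: allgood.
    by exists j.
by apply: le_trans (eval_all_top_terms_ge j s jm); exact: eval_bad_node.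
Qed.

Lemma laplace_top_le j : (j < 8 * 2 ^ K)%N ->
  laplace R T cell_prob n%:R (top_terms j) <=
  16 * expR (- (3 * expR ((1 - 2 * alpha) * (K%:R * ln 2)))).
Proof.
move=> jm; pose lap := laplace R T cell_prob n%:R.
have expge1 a : 1 <= expR ((1 - 2 * alpha) * (a%:R * ln 2)).
  apply: expR_ge1; apply: mulr_ge0; first by have := alpha_lt; lra.
  by apply: mulr_ge0 => //; rewrite ln_ge0//; lra.
have le4 := laplace_path_terms_le R T (cell_level K) (cell_block K)
  cell_prob n%:R (ler0n _ _) K (8 * 2 ^ K).
have {}le4 a i : (a <= K)%N -> (i < 8 * 2 ^ K * 2 ^ (K - a))%N ->
    lap (path_terms R T (cell_level K) (cell_block K) a i) <= 4.
  apply: le4 => b i' /andP[_ bK] i'm.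
  apply: le_trans (node_mass_ge b i' bK i'm).
  have := expge1 b; move: (expR _) => E E1.
  (* This is the origin of 768 = 6 * 128. *)
  have : 6 <= nu * alpha / 128 by have := nu_large; lra.
  by nra.
have lap0 a i : 0 <= lap (path_terms R T (cell_level K) (cell_block K) a i).
  exact/laplace_ge0/nonneg_path_terms.
rewrite /top_terms laplace_join ?supported_path_terms//.
have j2 : (j.*2.+1 < 8 * 2 ^ K * 2 ^ (K - k))%N.
  by rewrite subSnn expn1; lia.
apply: ler_pM; rewrite ?expR_ge0 ?mulr_ge0 ?lap0//.
  rewrite (_ : 16 = 4 * 4 :> R); last by rewrite -natrM.
  by apply: ler_pM; rewrite ?lap0 ?le4//; exact: ltnW.
rewrite ler_expR lerN2.
have := node_mass_ge K j (leqnn _); rewrite subnn muln1 => /(_ jm).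
have := expge1 K; move: (expR _) => E E1.
have : 6 <= nu * alpha / 128 by have := nu_large; lra.
move: (n%:R * _) => M h; nra.
Qed.

Lemma prob_not_hamiltonian_le :
  (P [set w | ~ hamiltonian Rad (N w) (fun i => X i w)] <=
   ((8 * 2 ^ K)%:R * (16 * expR (- (3 * expR ((1 - 2 * alpha) * (K%:R * ln 2))))))%:E)%E.
Proof.
have [_ [_ [lawN [_ indep]]]] := model.
apply: (le_trans (poisson_laplace_bound _ _ _ _ _ P N X T mk cell_prob n%:R
  (measurable_mark _ _ _) measurable_X measurable_N lawN cell_probE indep
  _ all_top_terms _ _ nonneg_all_top_terms _)) => //.
- exact: measurable_not_hamiltonian.
- by move=> w; exact: bad_event.
rewrite lee_fin /laplace /all_top_terms big_flatten big_map.
set c := 16 * _.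
apply: (@le_trans _ _ (\sum_(j <- iota 0 (8 * 2 ^ K)) c)).
  rewrite !big_seq; apply: ler_sum => j; rewrite mem_iota /= => jm.
  exact: laplace_top_le.
by rewrite big_const_seq count_predT size_iota iter_addr_0 mulr_natl.
Qed.

End FailureProbability.

(** * Asymptotics and conclusion *)

Lemma expR_ge_quadratic (R : realType) (x : R) : 0 <= x -> x ^+ 2 / 4 <= expR x.
Proof.
move=> x0.
have -> : expR x = expR (x / 2) ^+ 2 by rewrite -expRM_natl; congr expR; field.
have -> : x ^+ 2 / 4 = (x / 2) ^+ 2 by field.
have h0 : 0 <= x / 2 by lra.
apply: lerXn2r; rewrite ?nnegrE ?expR_ge0//.
by have := expR_ge1Dx (x / 2); lra.
Qed.

(* With s = K ln 2, AM-GM gives exp(beta s) >= (beta s)^2 / 4 >= s - 1 / beta^2. *)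
Lemma failure_bound_le (R : realType) (beta nu y : R) (K : nat) :
  0 < beta -> 0 < nu -> 0 < y -> y <= 4 ^+ K ->
  (8 * 2 ^ K)%:R * (16 * expR (- (3 * expR (beta * (K%:R * ln 2))))) <=
  128 * nu * expR (3 / beta ^+ 2) / (nu * y).
Proof.
move=> b0 nu0 y0 yK.
set s : R := K%:R * ln 2.
have s0 : 0 <= s by rewrite mulr_ge0// ln_ge0//; lra.
have X_ge : s - (beta ^+ 2)^-1 <= expR (beta * s).
  apply: le_trans (expR_ge_quadratic _ _ _); last by rewrite mulr_ge0// ltW.
  rewrite -subr_ge0 (_ : _ - _ = (beta * s / 2 - beta^-1) ^+ 2) ?sqr_ge0//.
  by field; rewrite gt_eqF.
have e_le : expR (- (3 * expR (beta * s))) <=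
    expR (3 / beta ^+ 2) * (expR s ^+ 3)^-1.
  by rewrite -expRM_natl -expRN -expRD ler_expR; lra.
have es : expR s = 2 ^+ K by rewrite /s expRM_natl lnK ?posrE.
rewrite es in e_le.
apply: (@le_trans _ _ ((8 * 2 ^ K)%:R * (16 * (expR (3 / beta ^+ 2) * ((2 ^+ K) ^+ 3)^-1)))).
  by rewrite ler_wpM2l// ler_wpM2l.
set E := expR (3 / beta ^+ 2).
have E0 : 0 <= E by exact: expR_ge0.
(* The 2 ^ K blocks use up one of the three factors 2 ^ (- K); the other two make 4 ^ (- K), of
   order 1 / n. *)
apply: (@le_trans _ _ (128 * E / 4 ^+ K)).
  have -> : 4 ^+ K = (2 ^+ K) ^+ 2 :> R.
    by rewrite -exprM mulnC exprM; congr (_ ^+ K); rewrite -natrX.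
  rewrite natrM natrX le_eqVlt; apply/orP; left; apply/eqP; field.
  by rewrite expf_neq0.
have -> : 128 * nu * E / (nu * y) = 128 * E / y by field; rewrite !gt_eqF.
by rewrite ler_wpM2l ?mulr_ge0// lef_pV2 ?posrE ?exprn_gt0.
Qed.

Lemma exists_pow4_bracket (R : realType) (y : R) (K0 : nat) :
  1 < y -> 4 ^+ K0 <= y ->
  exists K, [/\ (K0 <= K)%N, y <= 4 ^+ K & 4 ^+ K <= 4 * y].
Proof.
move=> y1 yK0.
have ex : exists K, y <= 4 ^+ K.
  exists (Num.truncn y).+1; apply: (le_trans (ltW (truncnS_gt y))).
  by rewrite -natrX ler_nat; apply/ltnW/ltn_expl.
case: (ex_minnP ex) => K yK minK; exists K; split => //.
  have := le_trans yK0 yK; rewrite -!natrX ler_nat leq_exp2l//.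
case: K yK minK => [|K] yK minK; first by move: yK; rewrite expr0; lra.
rewrite exprS ler_pM2l//; apply/ltW; rewrite ltNge; apply/negP => /minK.
by rewrite ltnn.
Qed.

Lemma cvg_div_mul_sqrt (R : realType) (C : R) :
  (fun n : nat => C / n%:R * Num.sqrt (n%:R)) @ \oo --> (0 : R).
Proof.
(* The shift avoids n = 0 and matches [harmonic], whose n-th term is 1 / (n + 1). *)
rewrite -cvg_shiftS.
rewrite (_ : (fun n => _) = (fun n : nat => C * Num.sqrt (harmonic n))); last first.
  apply/funext => n; rewrite /harmonic.
  have n0 : 0 < n.+1%:R :> R by [].
  rewrite -{1}[n.+1%:R]sqr_sqrtr ?ler0n//.
  rewrite sqrtrV ?ler0n//; field.
  by rewrite gt_eqF// sqrtr_gt0.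
suff : (fun n : nat => C * Num.sqrt (harmonic n)) @ \oo --> C * Num.sqrt (0 : R).
  by rewrite sqrtr0 mulr0.
apply: cvgMr.
by apply: continuous_cvg; [exact: sqrt_continuous|exact: cvg_harmonic].
Qed.

Theorem mainTheorem5 (R : realType) (alpha : R) :
  0 < alpha < 1 / 2 ->
  exists nu1 : R, forall nu : R, 0 < nu -> nu1 < nu ->
  exists eps : nat -> R,
    (fun n : nat => eps n * Num.sqrt (n%:R)) @ \oo --> (0 : R) /\
    forall (n : nat), nu < n%:R ->
    forall (d : measure_display) (Omega : measurableType d)
           (P : probability Omega R)
           (N : Omega -> nat) (X : nat -> Omega -> R * R),
      @is_KPKVB_poisson R d Omega P alpha nu n N X ->
      (P [set w | ~ hamiltonian (kp_radius nu n) (N w) (fun i => X i w)]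
         <= (eps n)%:E)%E.
Proof.
move=> /andP[a0 a1]; exists (768 / alpha) => nu nu0 nu_gt.
have nu_large : 768 <= nu * alpha by rewrite -ler_pdivrMr// ltW.
pose beta := 1 - 2 * alpha.
have b0 : 0 < beta by rewrite /beta; lra.
(* Chosen so that K0 - 3 exceeds 1 / (4 alpha); it also makes K positive. *)
pose K0 := (Num.truncn (4 * alpha)^-1 + 4)%N.
have K0_large : 1 <= 4 * alpha * (K0%:R - 3).
  have h : (4 * alpha)^-1 <= K0%:R - 3.
    have := truncnS_gt (4 * alpha)^-1; rewrite /K0 natrD -natr1; lra.
  have a4 : 0 < 4 * alpha by lra.
  by rewrite -(ler_pM2l a4) mulfV ?gt_eqF in h.
pose C1 := 128 * nu * expR (3 / beta ^+ 2).
have C1_ge0 : 0 <= C1 by rewrite !mulr_ge0 ?expR_ge0// ltW.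
(* For n <= nu * 4 ^ K0 the ratio C2 / n is at least 1, so these finitely many n are covered by the
   trivial bound on a probability. *)
pose C2 := nu * 4 ^+ K0.
have C2_ge0 : 0 <= C2 by rewrite mulr_ge0 ?exprn_ge0// ltW.
exists (fun n => (C1 + C2) / n%:R); split; first exact: cvg_div_mul_sqrt.
move=> n nun d Omega P N X model.
have n0 : 0 < n%:R :> R by exact: lt_trans nun.
have y1 : 1 < n%:R / nu by rewrite ltr_pdivlMr// mul1r.
have mF : measurable [set w | ~ hamiltonian (kp_radius nu n) (N w) (fun i => X i w)].
  by have [mN [mX _]] := model; exact: measurable_not_hamiltonian.
have [small|/ltW large] := leP (n%:R / nu) (4 ^+ K0).
  apply: (le_trans (probability_le1 P mF)); rewrite lee_fin.
  rewrite ler_pdivlMr// mul1r.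
  by move: small; rewrite ler_pdivrMr// mulrC -/C2; lra.
have [K [K0K yK Ky]] := exists_pow4_bracket _ _ _ y1 large.
case: K K0K yK Ky => [|k] K0K yK Ky; first by move: K0K; rewrite /K0 addn4.
have K_large : 1 <= 4 * alpha * (k.+1%:R - 3).
  apply: (le_trans K0_large); rewrite ler_wpM2l//; first by lra.
  by rewrite lerB// ler_nat.
apply: (le_trans (prob_not_hamiltonian_le R alpha nu n k d Omega P N X
  a0 a1 nu0 nu_large y1 yK Ky K_large model)).
rewrite lee_fin; apply: (le_trans (failure_bound_le _ _ nu (n%:R / nu) _ b0 nu0 _ yK)).
  exact: lt_trans y1.
rewrite (_ : nu * (n%:R / nu) = n%:R); last by field; rewrite gt_eqF.
by rewrite ler_wpM2r ?invr_ge0 ?ler0n// lerDl.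
Qed.
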